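(* Let $\rho_1,\rho_2,\beta\ge 0$ and let $U=(u_1,v_1,w_1,u_2,v_2,w_2)\in D(\mathcal{A})$. Then $u_1\in H^4(I_1)$, $v_1\in H^2(I_2)$ and $w_1\in H^4(I_3)$. In particular, the transmission conditions hold in the classical (pointwise) sense: $$u_1'''(l_1)-\rho_1u_2'(l_1)+v_1'(l_1)=0,\qquad w_1'''(l_2)-\rho_2w_2'(l_2)+v_1'(l_2)=0,\qquad u_1''(l_1)=0,\qquad w_1''(l_2)=0.$$
   Context: Let $l_0<l_1<l_2<l_3$ be real numbers, $I_1=(l_0,l_1)$, $I_2=(l_1,l_2)$, $I_3=(l_2,l_3)$, and let $\rho_1,\rho_2,\beta\ge 0$ be constants. Function spaces are complex-valued; primes and $^{(k)}$ denote (weak) derivatives in $x$. Spaces: $H^2_{l_0}:=\{u\in H^2(I_1):u(l_0)=u'(l_0)=0\}$ with inner product $\langle u,\tilde u\rangle_{H^2_{l_0}}:=\langle u'',\tilde u''\rangle_{L^2(I_1)}$; $H^2_{l_3}:=\{w\in H^2(I_3):w(l_3)=w'(l_3)=0\}$ with $\langle w,\tilde w\rangle_{H^2_{l_3}}:=\langle w'',\tilde w''\rangle_{L^2(I_3)}$. $\mathbb{H}:=\{(u,v,w)\in H^2_{l_0}\times H^1(I_2)\times H^2_{l_3}: u(l_1)=v(l_1),\ v(l_2)=w(l_2)\}$ with inner product $\langle u,\tilde u\rangle_{H^2_{l_0}}+\langle v',\tilde v'\rangle_{L^2(I_2)}+\langle w,\tilde w\rangle_{H^2_{l_3}}$; $\mathbb{L}:=L^2(I_1)\times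 L^2(I_2)\times L^2(I_3)$ with the sum of the $L^2$ inner products. $\mathcal{H}:=\mathbb{H}\times\mathbb{L}$ with the sum inner product; it is a Hilbert space. Elements are written $U=(u_1,v_1,w_1,u_2,v_2,w_2)$ with $(u_1,v_1,w_1)\in\mathbb{H}$, $(u_2,v_2,w_2)\in\mathbb{L}$. Formal operator: $AU:=\big(u_2,\ v_2,\ w_2,\ -u_1^{(4)}+\rho_1u_2'',\ v_1''-\beta v_2,\ -w_1^{(4)}+\rho_2w_2''\big)$. For $U,\tilde U\in\mathbb{H}\times\mathbb{H}$ put $$a(U,\tilde U):=\langle u_2,\tilde u_1\rangle_{H^2_{l_0}}+\langle v_2',\tilde v_1'\rangle_{L^2(I_2)}+\langle w_2,\tilde w_1\rangle_{H^2_{l_3}}-\langle u_1'',\tilde u_2''\rangle_{L^2(I_1)}-\rho_1\langle u_2',\tilde u_2'\rangle_{L^2(I_1)}-\beta\langle v_2,\tilde v_2\rangle_{L^2(I_2)}-\langle v_1',\tilde v_2'\rangle_{L^2(I_2)}-\langle w_1'',\tilde w_2''\rangle_{L^2(I_3)}-\rho_2\langle w_2',\tilde w_2'\rangle_{L^2(I_3)}.$$ $U$ satisfies the transmission conditions in the weak sense if $\langle AU,\tilde U\rangle_{\mathcal{H}}=a(U,\tilde U)$ for all $\tilde U\in\mathbb{H}\times\mathbb{H}$. The operator $\mathcal{A}:D(\mathcal{A})\subset\mathcal{H}\to\mathcal{H}$ is $\mathcal{A}U:=AU$ with domain $D(\mathcal{A}):=\{U\in\mathbb{H}\times\mathbb{H}: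 u_1^{(4)}\in L^2(I_1),\ v_1''\in L^2(I_2),\ w_1^{(4)}\in L^2(I_3),\ U \text{ satisfies the transmission conditions in the weak sense}\}$. *)

(* Defs.v *)
From HB Require Import structures.
From mathcomp Require Import all_boot all_order all_algebra.
From mathcomp Require Import all_classical all_reals all_analysis.
From mathcomp Require Import complex.

Set Implicit Arguments.
Unset Strict Implicit.
Unset Printing Implicit Defensive.

Import Order.TTheory GRing.Theory Num.Theory.
Import numFieldNormedType.Exports.

Local Open Scope classical_set_scope.
Local Open Scope ring_scope.
Local Open Scope complex_scope.

(* An element of a function space over the interval (a, b) is represented by a
   function R -> R[i]; only its a.e. class on `]a, b[ matters, its values
   elsewhere are never used.  Measurability, local integrability, continuity and
   integration of a complex-valued function are taken componentwise. *)

Definition cintegral (R : realType) (a b : R) (f : R -> R[i]) : R[i] :=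
  (\int[lebesgue_measure]_(x in `]a, b[) complex.Re (f x)) +i*
  (\int[lebesgue_measure]_(x in `]a, b[) complex.Im (f x)).

Definition clocally_integrable (R : realType) (a b : R) (f : R -> R[i]) :=
  locally_integrable `]a, b[ (fun x => complex.Re (f x)) /\
  locally_integrable `]a, b[ (fun x => complex.Im (f x)).

Definition inL2 (R : realType) (a b : R) (f : R -> R[i]) :=
  [/\ measurable_fun `]a, b[ (fun x => complex.Re (f x)),
      measurable_fun `]a, b[ (fun x => complex.Im (f x)) &
      lebesgue_measure.-integrable `]a, b[
        (fun x => (complex.Re (f x) ^+ 2 + complex.Im (f x) ^+ 2)%:E)].

Definition dotL2 (R : realType) (a b : R) (f g : R -> R[i]) : R[i] :=
  cintegral a b (fun x => f x * conjc (g x)).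

Definition test_function (R : realType) (a b : R) (phi : R -> R) :=
  (forall (n : nat) (x : R), derivable (phi^`(n))%classic x 1) /\
  (exists K : set R, [/\ compact K, K `<=` `]a, b[ &
     forall x, ~ K x -> phi x = 0]).

Definition is_wderiv (R : realType) (a b : R) (k : nat) (f g : R -> R[i]) :=
  [/\ clocally_integrable a b f, clocally_integrable a b g &
      forall phi : R -> R, test_function a b phi ->
        cintegral a b (fun x => f x * ((phi^`(k))%classic x)%:C) =
        (-1) ^+ k * cintegral a b (fun x => g x * (phi x)%:C)].

(* A chosen k-th weak derivative on (a, b), unique up to a null set; it is the
   junk value 0 when there is none, so membership conditions on weak derivatives
   are stated with [wderiv_inL2], which asserts existence. *)
Definition wderiv (R : realType) (a b : R) (k : nat) (f : R -> R[i]) :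
    R -> R[i] :=
  xget (fun=> 0) [set g | is_wderiv a b k f g].

Definition wderiv_inL2 (R : realType) (a b : R) (k : nat) (f : R -> R[i]) :=
  exists g, is_wderiv a b k f g /\ inL2 a b g.

Definition inH (R : realType) (k : nat) (a b : R) (f : R -> R[i]) :=
  inL2 a b f /\ forall j, (0 < j <= k)%N -> wderiv_inL2 a b j f.

Definition continuous_rep (R : realType) (a b : R) (f g : R -> R[i]) :=
  [/\ {within `[a, b], continuous (fun x => complex.Re (g x))},
      {within `[a, b], continuous (fun x => complex.Im (g x))} &
      {ae lebesgue_measure, forall x, `]a, b[%classic x -> f x = g x}].

(* Pointwise value at c in [a, b] of the a.e. class of f: the value of its
   representative that is continuous on the closed interval, endpoints included
   (it exists and is unique on [a, b] for classes in H^1(a, b), a < b). *)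
Definition pval (R : realType) (a b : R) (f : R -> R[i]) (c : R) : R[i] :=
  xget (fun=> 0) [set g | continuous_rep a b f g] c.

Definition inH2_left (R : realType) (l0 l1 : R) (u : R -> R[i]) :=
  [/\ inH 2 l0 l1 u, pval l0 l1 u l0 = 0 &
      pval l0 l1 (wderiv l0 l1 1 u) l0 = 0].

Definition inH2_right (R : realType) (l2 l3 : R) (w : R -> R[i]) :=
  [/\ inH 2 l2 l3 w, pval l2 l3 w l3 = 0 &
      pval l2 l3 (wderiv l2 l3 1 w) l3 = 0].

Definition dotH2 (R : realType) (a b : R) (f g : R -> R[i]) : R[i] :=
  dotL2 a b (wderiv a b 2 f) (wderiv a b 2 g).

Definition inHH (R : realType) (l0 l1 l2 l3 : R) (u v w : R -> R[i]) :=
  [/\ inH2_left l0 l1 u, inH 1 l1 l2 v, inH2_right l2 l3 w,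
      pval l0 l1 u l1 = pval l1 l2 v l1 &
      pval l1 l2 v l2 = pval l2 l3 w l2].

Definition dotHH (R : realType) (l0 l1 l2 l3 : R)
    (u v w u' v' w' : R -> R[i]) : R[i] :=
  dotH2 l0 l1 u u' + dotL2 l1 l2 (wderiv l1 l2 1 v) (wderiv l1 l2 1 v') +
  dotH2 l2 l3 w w'.

Definition dotLL (R : realType) (l0 l1 l2 l3 : R)
    (u v w u' v' w' : R -> R[i]) : R[i] :=
  dotL2 l0 l1 u u' + dotL2 l1 l2 v v' + dotL2 l2 l3 w w'.

Record state (R : realType) := State {
  u1 : R -> R[i]; v1 : R -> R[i]; w1 : R -> R[i];
  u2 : R -> R[i]; v2 : R -> R[i]; w2 : R -> R[i] }.

Definition inHHxHH (R : realType) (l0 l1 l2 l3 : R) (U : state R) :=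
  inHH l0 l1 l2 l3 (u1 U) (v1 U) (w1 U) /\
  inHH l0 l1 l2 l3 (u2 U) (v2 U) (w2 U).

(* The inner product of the energy space HH x LL. *)
Definition dotE (R : realType) (l0 l1 l2 l3 : R) (U V : state R) : R[i] :=
  dotHH l0 l1 l2 l3 (u1 U) (v1 U) (w1 U) (u1 V) (v1 V) (w1 V) +
  dotLL l0 l1 l2 l3 (u2 U) (v2 U) (w2 U) (u2 V) (v2 V) (w2 V).

Definition opA (R : realType) (l0 l1 l2 l3 rho1 rho2 beta : R) (U : state R) :
    state R :=
  State (u2 U) (v2 U) (w2 U)
    (fun x => - wderiv l0 l1 4 (u1 U) x + rho1%:C * wderiv l0 l1 2 (u2 U) x)
    (fun x => wderiv l1 l2 2 (v1 U) x - beta%:C * v2 U x)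
    (fun x => - wderiv l2 l3 4 (w1 U) x + rho2%:C * wderiv l2 l3 2 (w2 U) x).

Definition aform (R : realType) (l0 l1 l2 l3 rho1 rho2 beta : R)
    (U V : state R) : R[i] :=
  dotH2 l0 l1 (u2 U) (u1 V)
  + dotL2 l1 l2 (wderiv l1 l2 1 (v2 U)) (wderiv l1 l2 1 (v1 V))
  + dotH2 l2 l3 (w2 U) (w1 V)
  - dotL2 l0 l1 (wderiv l0 l1 2 (u1 U)) (wderiv l0 l1 2 (u2 V))
  - rho1%:C * dotL2 l0 l1 (wderiv l0 l1 1 (u2 U)) (wderiv l0 l1 1 (u2 V))
  - beta%:C * dotL2 l1 l2 (v2 U) (v2 V)
  - dotL2 l1 l2 (wderiv l1 l2 1 (v1 U)) (wderiv l1 l2 1 (v2 V))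
  - dotL2 l2 l3 (wderiv l2 l3 2 (w1 U)) (wderiv l2 l3 2 (w2 V))
  - rho2%:C * dotL2 l2 l3 (wderiv l2 l3 1 (w2 U)) (wderiv l2 l3 1 (w2 V)).

Definition weak_transmission (R : realType)
    (l0 l1 l2 l3 rho1 rho2 beta : R) (U : state R) :=
  forall V : state R, inHHxHH l0 l1 l2 l3 V ->
    dotE l0 l1 l2 l3 (opA l0 l1 l2 l3 rho1 rho2 beta U) V =
    aform l0 l1 l2 l3 rho1 rho2 beta U V.

Definition domA (R : realType) (l0 l1 l2 l3 rho1 rho2 beta : R)
    (U : state R) :=
  [/\ inHHxHH l0 l1 l2 l3 U,
      wderiv_inL2 l0 l1 4 (u1 U),
      wderiv_inL2 l1 l2 2 (v1 U),
      wderiv_inL2 l2 l3 4 (w1 U) &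
      weak_transmission l0 l1 l2 l3 rho1 rho2 beta U].

(* Main.v *)
Require Import Defs.
From mathcomp Require Import all_boot all_order all_algebra.
From mathcomp Require Import all_classical all_reals all_analysis.
From mathcomp Require Import measurable_realfun complex.
From mathcomp Require Import ring lra.

(** Why the theorem is true.  Since [u1] has weak derivatives of orders 2 and 4
in [L2], the fourth derivative is the second weak derivative of the second one.
In dimension one, integrating [u1''''] from the left endpoint gives a function
[G] which differs from the missing third derivative by a constant: this is the
du Bois-Reymond lemma, according to which a functional of test functions that
vanishes on derivatives of test functions is a multiple of the integral
([functional_multiple_of_integral]).  Hence [u1'''] exists, and [u1'''] and
[u1''] coincide almost everywhere with primitives of integrable functions
([H4_structure]; [H2_structure] is the analogue for the derivatives of [v1] and
of the velocities).  These primitives are continuous up to the endpoints, so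
they are the representatives that give the pointwise values in the transmission
conditions.

Primitives of integrable functions can be integrated by parts
([primitive_parts]), a consequence of the theorem of Fubini on a triangle.  In
the weak transmission identity, tested with a state whose first three components
vanish, this moves all the derivatives back and cancels every integral; only
boundary values remain ([boundary_identity]).  It is enough to test with real
polynomials: cubics with a double zero at the clamped end and a simple zero at
the joint isolate [u1''] and [w1''] at the joints, and a square with a double
zero at the clamped end, glued to an affine function on the middle interval,
isolates each of the two force balances.

Everything rests on the fundamental lemma of the calculus of variations
([fundamental_lemma]), which makes weak derivatives unique up to null sets.  It
needs test functions approaching the indicator of an interval: if [psi] is a
smooth function with values in [[0, 1]] that is positive exactly on [(c, d)],
then [1 - (1 - psi) ^ n] does so, pointwise and boundedly, and dominated
convergence shows that the integral of the given function over every interval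
is zero.

Measure-theoretic statements are proved for real functions and transferred to
complex ones through real and imaginary parts. *)

Set Implicit Arguments.
Unset Strict Implicit.
Unset Printing Implicit Defensive.

Import Order.TTheory GRing.Theory Num.Theory.
Import numFieldNormedType.Exports.

Local Open Scope classical_set_scope.
Local Open Scope ring_scope.

Local Notation mu := lebesgue_measure.

(** * Smooth functions *)

Definition smooth (R : realType) (f : R -> R) :=
  forall n x, derivable (f^`(n))%classic x 1.

Lemma smooth_derivable (R : realType) (f : R -> R) x : smooth f ->
  derivable f x 1.
Proof. by move=> /(_ 0%N). Qed.

Lemma smooth_derive1 (R : realType) (f : R -> R) :
  smooth f -> smooth (f^`())%classic.
Proof.
by move=> sf n x; have := sf n.+1 x; rewrite /derive1n iterSr.
Qed.

Lemma is_derive1_smooth (R : realType) (f : R -> R) (x : R) :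
  smooth f -> is_derive x 1 f ((f^`())%classic x).
Proof.
by move=> /(_ 0%N x) df; rewrite derive1E; exact: derivableP.
Qed.

Lemma derive1_fun (R : realType) (f g : R -> R) :
  (forall x : R, is_derive x 1 f (g x)) -> (f^`())%classic = g.
Proof.
by move=> fg; apply/funext => x; rewrite derive1E; exact: derive_val.
Qed.

(** Smoothness is coinductive: a class of functions stable under
differentiation consists of smooth functions.  The closure properties below
follow by exhibiting such a class. *)
Lemma smooth_coind (R : realType) (P : (R -> R) -> Prop) :
  (forall f, P f -> exists2 g, P g & forall x : R, is_derive x 1 f (g x)) ->
  forall f, P f -> smooth f.
Proof.
move=> Pd f Pf n; elim: n f Pf => [|n IH] f Pf x.
  by have [g _ fg] := Pd f Pf; exact: ex_derive.
have [g Pg fg] := Pd f Pf.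
by rewrite /derive1n iterSr -/(derive1n _ _) (derive1_fun fg); exact: IH.
Qed.

Lemma smooth_cst (R : realType) (c : R) : smooth (fun=> c).
Proof.
apply: (@smooth_coind _ (fun f => exists c, f = fun=> c)); last by exists c.
move=> _ [k ->]; exists (fun=> 0); first by exists 0.
by move=> x; exact: is_derive_cst.
Qed.

Lemma smooth_horner (R : realType) (p : {poly R}) : smooth (horner p).
Proof.
apply: (@smooth_coind _ (fun f => exists p : {poly R}, f = horner p));
  last by exists p.
move=> _ [q ->]; exists (horner q^`()); first by exists q^`().
by move=> x; rewrite derivE derive1E; apply: derivableP;
  exact: derivable_horner.
Qed.

Arguments smooth_cst {R} c _ _.
Arguments smooth_horner {R} p _ _.

(** The [n]-th derivative of a product or of a composition has no convenient
closed form, so the closure properties are proved at once: this class contains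
the smooth functions and is stable under differentiation because the sum,
product and chain rules stay within it. *)
Inductive smooth_alg (R : realType) : (R -> R) -> Prop :=
| Alg_smooth f : smooth f -> smooth_alg f
| Alg_add f g : smooth_alg f -> smooth_alg g -> smooth_alg (fun x => f x + g x)
| Alg_mul f g : smooth_alg f -> smooth_alg g -> smooth_alg (fun x => f x * g x)
| Alg_affine f c d : smooth_alg f -> smooth_alg (fun x => f (c * x + d)).

Lemma smooth_alg_smooth (R : realType) (f : R -> R) : smooth_alg f -> smooth f.
Proof.
apply: smooth_coind => {}f; elim=> [{}f sf|{}f g Af [f' Af' ff'] Ag [g' Ag' gg']
    |{}f g Af [f' Af' ff'] Ag [g' Ag' gg']|{}f c d Af [f' Af' ff']].
- exists (f^`())%classic; first by apply: Alg_smooth; exact: smooth_derive1.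
  by move=> x; exact: is_derive1_smooth.
- exists (fun x => f' x + g' x); first exact: Alg_add.
  by move=> x; exact: is_deriveD.
- exists (fun x => f x * g' x + g x * f' x).
    by apply: Alg_add; exact: Alg_mul.
  by move=> x; have := @is_deriveM _ _ f g x 1 _ _ (ff' x) (gg' x).
- exists (fun x => f' (c * x + d) * c).
    by apply: Alg_mul; [exact: Alg_affine|apply: Alg_smooth; exact: smooth_cst].
  move=> x; have dg : is_derive x 1 (fun y : R => c * y + d) c.
    have -> : (fun y : R => c * y + d) = horner (c *: 'X + d%:P).
      by apply/funext => y; rewrite !hornerE.
    have := is_derive1_smooth x (smooth_horner (c *: 'X + d%:P)).
    by rewrite -derivE derivD derivZ derivX derivC !hornerE.
  exact: (@is_derive1_comp _ f _ x _ _ (ff' _) dg).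
Qed.

Lemma smoothD (R : realType) (f g : R -> R) :
  smooth f -> smooth g -> smooth (fun x => f x + g x).
Proof.
by move=> sf sg; apply: smooth_alg_smooth; apply: Alg_add; exact: Alg_smooth.
Qed.

Lemma smoothM (R : realType) (f g : R -> R) :
  smooth f -> smooth g -> smooth (fun x => f x * g x).
Proof.
by move=> sf sg; apply: smooth_alg_smooth; apply: Alg_mul; exact: Alg_smooth.
Qed.

Lemma smoothX (R : realType) (f : R -> R) n :
  smooth f -> smooth (fun x => f x ^+ n).
Proof.
move=> sf; elim: n => [|n IH]; first exact: smooth_cst.
by under eq_fun do rewrite exprS; exact: smoothM.
Qed.

Lemma smooth_affine (R : realType) (f : R -> R) c d :
  smooth f -> smooth (fun x => f (c * x + d)).
Proof.
by move=> sf; apply: smooth_alg_smooth; apply: Alg_affine; exact: Alg_smooth.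
Qed.

(** * Smooth bumps *)

(** The functions [p(1/x) exp(-1/x)], extended by 0 to the left of 0; the
family indexed by [p] is stable under differentiation, while [exp(-1/x)] alone
is not. *)
Definition flat (R : realType) (p : {poly R}) (x : R) : R :=
  if 0 < x then p.[x^-1] * expR (- x^-1) else 0.

(** With [y = 1/x] this is [y ^ (n+1) / (n+1)! <= exp y]. *)
Lemma flatXn_lip (R : realType) n (x : R) :
  `|flat ('X^n) x| <= (n.+1)`!%:R * `|x|.
Proof.
rewrite /flat; case: ifP => x0; last by rewrite normr0 mulr_ge0.
have y0 : 0 < x^-1 by rewrite invr_gt0.
rewrite hornerXn (ger0_norm (ltW x0)) ger0_norm ?mulr_ge0 ?expR_ge0
  ?exprn_ge0// ?(ltW y0)//.
rewrite expRN.
rewrite ler_pdivrMr ?expR_gt0// -ler_pdivrMl ?mulr_gt0 ?ltr0n ?fact_gt0//.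
have := expR_ge1Dxn n (ltW y0); apply: le_trans.
rewrite ler_wpDl// invfM mulrAC exprS mulrC.
by rewrite -[in leRHS]mulrA [in leRHS](mulrC _ _^-1).
Qed.

(** A bound by a multiple of [|x|] for all [p] gives both the continuity at 0
and, applied to [p * 'X], the differentiability at 0. *)
Lemma flat_lip (R : realType) (p : {poly R}) :
  exists C, forall x, `|flat p x| <= C * `|x|.
Proof.
exists (\sum_(i < size p) `|p`_i| * (i.+1)`!%:R) => x.
have -> : flat p x = \sum_(i < size p) p`_i * flat 'X^i x.
  rewrite /flat; case: ifP => x0; last by under eq_bigr do rewrite mulr0;
    rewrite big1.
  rewrite horner_coef mulr_suml; apply: eq_bigr => i _.
  by rewrite hornerXn mulrA.
rewrite mulr_suml; apply: (le_trans (ler_norm_sum _ _ _));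
  apply: ler_sum => i _.
by rewrite normrM -mulrA ler_wpM2l// flatXn_lip.
Qed.

Lemma flat_continuous0 (R : realType) (p : {poly R}) :
  {for 0, continuous (flat p)}.
Proof.
have [C fC] := flat_lip p.
rewrite /prop_for /continuous_at {2}/flat ltxx.
apply: norm_cvg0.
apply: (@squeeze_cvgr _ _ _ _ (fun=> 0) (fun x => C * `|x|)).
- by near=> x; rewrite normr_ge0 fC.
- exact: cvg_cst.
- rewrite -[X in _ --> X](mulr0 C); apply: cvgMr.
  by rewrite -[X in _ --> X](normr0 R); apply: cvg_norm; exact: cvg_id.
Unshelve. all: by end_near. Qed.

(** At 0 the difference quotient of [flat p] is [flat (p * 'X)], whose limit
is 0. *)
Lemma is_derive_flat (R : realType) (p : {poly R}) (x : R) :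
  is_derive x 1 (flat p) (flat ('X^2 * (p - p^`())) x).
Proof.
have [x0|x0|->] := ltgtP x 0.
- have -> : flat ('X^2 * (p - p^`())) x = 0 by rewrite /flat ltNge (ltW x0).
  apply: (@near_eq_is_derive _ _ _ (fun=> 0)).
    by near=> y; rewrite /flat ltNge ltW//; near: y; exact: lt_nbhsl.
- have -> : flat ('X^2 * (p - p^`())) x =
  ('X^2 * (p - p^`())).[x^-1] * expR (- x^-1)
    by rewrite /flat x0.
  have dV : is_derive x 1 (fun y : R => y^-1) (- x ^- 2).
    have x0' : id x != 0 by rewrite gt_eqF.
    have := is_deriveV x0' (is_derive_id x 1).
    by rewrite /GRing.scale/= mulr1.
  have dp : is_derive x 1 (horner p \o (fun y : R =>
    y^-1)) (p^`().[x^-1] * (- x ^- 2)).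
    by apply: is_derive1_comp; rewrite derivE;
      exact: (is_derive1_smooth _ (smooth_horner p)).
  have de : is_derive x 1 (expR \o (fun y : R =>
    - y^-1)) (expR (- x^-1) * x ^- 2).
    apply: is_derive1_comp; rewrite -[X in is_derive _ _ _ X]opprK;
      exact: is_deriveN.
  have := @is_deriveM _ _ _ _ x 1 _ _ dp de.
  set D := (X in is_derive _ _ _ X) => dM.
  suff <- : D = ('X^2 * (p - p^`())).[x^-1] * expR (- x^-1).
    apply: near_eq_is_derive dM.
    by near=> y; rewrite /flat ifT//; near: y; exact: lt_nbhsr.
  transitivity (p.[x^-1] * (expR (- x^-1) * x ^- 2) +
      expR (- x^-1) * (p^`().[x^-1] * - x ^- 2)); first by [].
  have alg (u v w y : R) : u * (w * y) + w * (v * - y) =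
    y * (u - v) * w by ring.
  rewrite hornerM hornerXn hornerD hornerN exprVn.
  exact: alg.
- apply/is_derive1_caratheodory; exists (flat (p * 'X)); split.
  + move=> z; rewrite /flat ltxx !subr0; case: ifP => z0; last by rewrite mul0r.
    by rewrite hornerM hornerX [in RHS]mulrAC divfK ?gt_eqF.
  + exact: flat_continuous0.
  + by rewrite /flat ltxx.
Unshelve. all: by end_near. Qed.

Lemma smooth_flat (R : realType) (p : {poly R}) : smooth (flat p).
Proof.
apply: (@smooth_coind _ (fun f => exists p : {poly R}, f = flat p));
  last by exists p.
move=> _ [q ->]; exists (flat ('X^2 * (q - q^`()))); first by eexists.
by move=> x; exact: is_derive_flat.
Qed.

(** A smooth function with values in [[0, 1]] that is positive exactly on
[(c, d)]. *)
Definition bump (R : realType) (c d x : R) : R :=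
  flat 1 (x - c) * flat 1 (d - x).

Lemma smooth_bump (R : realType) (c d : R) : smooth (bump c d).
Proof.
have -> : bump c d = fun x => flat 1 (1 * x + - c) * flat 1 (-1 * x + d).
  by apply/funext => x; rewrite /bump mul1r mulN1r (addrC (- x)).
by apply: smoothM; apply: smooth_affine; exact: smooth_flat.
Qed.

Lemma flat1_itv (R : realType) (x : R) : 0 <= flat 1 x <= 1.
Proof.
rewrite /flat; case: ifP => x0; last by rewrite lexx ler01.
by rewrite hornerE mul1r expR_ge0/= -expR0 ler_expR oppr_le0 invr_ge0 ltW.
Qed.

Lemma flat1_gt0 (R : realType) (x : R) : (0 < flat 1 x) = (0 < x).
Proof.
by rewrite /flat; case: ifP => x0; rewrite ?ltxx// hornerE mul1r expR_gt0.
Qed.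

Lemma bump_itv (R : realType) (c d x : R) : 0 <= bump c d x <= 1.
Proof.
rewrite /bump; have /andP[? ?] := flat1_itv (x - c).
have /andP[? ?] := flat1_itv (d - x).
by rewrite mulr_ge0//= mulr_ile1.
Qed.

Lemma bump_gt0 (R : realType) (c d x : R) : (0 < bump c d x) = (c < x < d).
Proof.
rewrite /bump; have /andP[h1 _] := flat1_itv (x - c).
have /andP[h2 _] := flat1_itv (d - x).
rewrite lt0r mulf_eq0 negb_or mulr_ge0// andbT.
have := flat1_gt0 (x - c); rewrite lt0r h1 andbT => ->.
have := flat1_gt0 (d - x); rewrite lt0r h2 andbT => ->.
by rewrite !subr_gt0.
Qed.

Lemma bump_eq0 (R : realType) (c d x : R) : ~~ (c < x < d) -> bump c d x = 0.
Proof.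
rewrite -bump_gt0 -leNgt => h; apply/eqP; rewrite eq_le h/=.
by have /andP[] := bump_itv c d x.
Qed.

(** * Test functions *)

Lemma smooth_continuous (R : realType) (f : R -> R) : smooth f -> continuous f.
Proof.
by move=> sf x; apply: differentiable_continuous; apply/derivable1_diffP;
  exact: smooth_derivable.
Qed.

(** A compact subset of [(a, b)] lies in a segment [[c, d]] with
[a < c] and [d < b]; segments are easier to combine than compact sets. *)
Lemma test_functionP (R : realType) (a b : R) (phi : R -> R) : a < b ->
  test_function a b phi <->
  smooth phi /\ exists c d, [/\ a < c, c <= d, d < b &
     forall x, ~~ (c <= x <= d) -> phi x = 0].
Proof.
move=> ab; split=> [[sphi [K [cK Kab K0]]]|[sphi [c [d [ac cd db phi0]]]]].
  split=> //; have [K0'|/set0P K0'] := eqVneq K set0.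
    exists ((a + b) / 2), ((a + b) / 2); split=> //; [lra|lra|].
    by move=> x _; apply: K0; rewrite K0'.
  have cid : {within K, continuous (@idfun R)}.
    by apply: continuous_subspaceT => x; exact: cvg_id.
  have [c /set_mem cK' cmin] := compact_EVT_min K0' cK cid.
  have [d /set_mem dK' dmax] := compact_EVT_max K0' cK cid.
  have := Kab _ cK'; have := Kab _ dK';
    rewrite /= !in_itv/= => /andP[_ db] /andP[ac _].
  exists c, d; split=> //.
    by have := cmin d; rewrite inE; apply.
  move=> x xcd; apply: K0 => Kx; case/negP: xcd.
  by apply/andP; split; [apply: cmin|apply: dmax]; rewrite inE.
split=> //; exists `[c, d]%classic; split.
- exact: segment_compact.
- by move=> x; rewrite /= !in_itv/= => /andP[? ?]; apply/andP; split; lra.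
- by move=> x /= /negP; rewrite in_itv/=; exact: phi0.
Qed.

Lemma test_derive1 (R : realType) (a b : R) (phi : R -> R) : a < b ->
  test_function a b phi -> test_function a b (phi^`())%classic.
Proof.
move=> ab /(test_functionP _ ab)[sphi [c [d [ac cd db phi0]]]].
apply/(test_functionP _ ab); split; first exact: smooth_derive1.
exists c, d; split=> // x xcd.
rewrite derive1E -[RHS](@derive_cst R R R 0 x 1).
apply: near_eq_derive.
move: xcd; rewrite negb_and -!ltNge => /orP[xc|dx]; near=> y.
  by apply: phi0; rewrite negb_and -!ltNge; apply/orP; left; near: y;
    exact: lt_nbhsl.
by apply: phi0; rewrite negb_and -!ltNge; apply/orP; right; near: y;
  exact: lt_nbhsr.
Unshelve. all: by end_near. Qed.

(** * Integrability on intervals and null sets *)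

Definition integrable_oo (R : realType) (a b : R) (f : R -> R) :=
  mu.-integrable `]a, b[ (EFin \o f).

Lemma within_measurable (R : realType) (a b : R) (p : R -> R) :
  {within `[a, b], continuous p} -> measurable_fun `[a, b] p.
Proof.
by move=> cp; apply: subspace_continuous_measurable_fun => //;
  exact: measurable_itv.
Qed.

Lemma within_bounded (R : realType) (a b : R) (p : R -> R) :
  {within `[a, b], continuous p} -> [bounded p x | x in `[a, b]%classic].
Proof.
move=> cp.
have : compact (p @` `[a, b]) by apply: continuous_compact => //;
  exact: segment_compact.
move=> /compact_bounded[M [Mr MP]]; exists M; split=> // y My x xab.
by apply: (MP y My); exists x.
Qed.

Lemma integrableM_cc (R : realType) (a b : R) (f p : R -> R) :
  mu.-integrable `[a, b] (EFin \o f) -> {within `[a, b], continuous p} ->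
  mu.-integrable `[a, b] (EFin \o (fun x => f x * p x)).
Proof.
move=> fi cp.
have := @integrableMl _ (measurableTypeR R) R mu `[a, b]%classic
  (measurable_itv _) (EFin \o f) p fi (within_measurable cp) (within_bounded
    cp).
by apply: eq_integrable.
Qed.

(** Endpoints are negligible.  Integrability is stated on open intervals, but
continuity up to the boundary is used on closed ones. *)
Lemma integrable_oocc (R : realType) (a b : R) (f : R -> R) :
  integrable_oo a b f <-> mu.-integrable `[a, b] (EFin \o f).
Proof.
rewrite /integrable_oo; split=> /integrableP[mf fi]; apply/integrableP.
  have mf' : measurable_fun `[a, b] (EFin \o f).
    exact/emeasurable_fun_itv_obnd_cbndP/emeasurable_fun_itv_bndo_bndcP.
  split=> //; rewrite (@integral_itv_bndoo _ _ _ _ true false)//.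
  exact: measurableT_comp.
have mf' : measurable_fun `]a, b[ (EFin \o f).
  exact/emeasurable_fun_itv_bndo_bndcP/emeasurable_fun_itv_obnd_cbndP.
split=> //; rewrite -(@integral_itv_bndoo _ _ _ _ true false)//.
exact: measurableT_comp.
Qed.

Lemma integrable_ooM (R : realType) (a b : R) (f p : R -> R) :
  integrable_oo a b f -> {within `[a, b], continuous p} ->
    integrable_oo a b (fun x => f x * p x).
Proof. by move=> /integrable_oocc fi cp; apply/integrable_oocc;
  exact: integrableM_cc. Qed.

Lemma locint_integrable_cc (R : realType) (a b c d : R) (f : R -> R) :
  a < c -> d < b ->
  locally_integrable `]a, b[ f -> mu.-integrable `[c, d] (EFin \o f).
Proof.
move=> ac db [mf _ lf].
have sub : `[c, d] `<=` `]a, b[.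
  by move=> x; rewrite /= !in_itv/= => /andP[? ?]; apply/andP; split; lra.
apply/integrableP; split.
  apply/measurable_EFinP; exact: measurable_funS mf.
by apply: lf => //; exact: segment_compact.
Qed.

Lemma locint_test_integrable (R : realType) (a b : R) (f phi : R -> R) :
  a < b ->
  locally_integrable `]a, b[ f -> test_function a b phi ->
    integrable_oo a b (fun x => f x * phi x).
Proof.
move=> ab lf /(test_functionP _ ab)[sphi [c [d [ac cd db phi0]]]].
have := integrableM_cc (locint_integrable_cc ac db lf) (continuous_subspaceT
  (smooth_continuous sphi)).
move=> fp; rewrite /integrable_oo.
have -> : EFin \o (fun x => f x * phi x) =
  (EFin \o (fun x => f x * phi x)) \_ `[c, d].
  apply/funext => x; rewrite patchE; case: ifPn => //;
    rewrite notin_setE/= in_itv/= => /negP xcd.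
  by rewrite phi0// mulr0.
apply/integrable_restrict => //; rewrite setIidr//.
by move=> x; rewrite /= !in_itv/= => /andP[? ?]; apply/andP; split; lra.
Qed.

Lemma integrable_ooZ (R : realType) (a b k : R) (f : R -> R) :
  integrable_oo a b f -> integrable_oo a b (fun x => k * f x).
Proof.
move=> fi; have := @integrableZl _ (measurableTypeR R) R mu _ (measurable_itv
  `]a, b[) k _ fi.
by apply: eq_integrable.
Qed.

Lemma integrable_ooD (R : realType) (a b : R) (f g : R -> R) :
  integrable_oo a b f -> integrable_oo a b g ->
    integrable_oo a b (fun x => f x + g x).
Proof.
move=> fi gi; have := @integrableD _ (measurableTypeR R) R mu _ (measurable_itv
  `]a, b[) _ _ fi gi.
by apply: eq_integrable.
Qed.

Lemma continuous_integrable_oo (R : realType) (a b : R) (f : R -> R) :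
  {within `[a, b], continuous f} -> integrable_oo a b f.
Proof.
by move=> cf; apply/integrable_oocc;
  apply: continuous_compact_integrable => //; exact: segment_compact.
Qed.

Lemma cst_integrable_oo (R : realType) (a b k : R) :
  integrable_oo a b (fun=> k).
Proof. by apply: continuous_integrable_oo; apply: continuous_subspaceT => x;
  exact: cvg_cst. Qed.

Lemma integrable_ooS (R : realType) (a b c d : R) (f : R -> R) :
  a <= c -> d <= b ->
  integrable_oo a b f -> integrable_oo c d f.
Proof.
move=> ac db; apply: integrableS => //; move=> x;
  rewrite /= !in_itv/= => /andP[? ?].
by apply/andP; split; lra.
Qed.

Lemma ae_imply (R : realType) (P Q : R -> Prop) : (forall x, P x -> Q x) ->
  {ae @mu R, forall x, P x} -> {ae @mu R, forall x, Q x}.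
Proof. by move=> PQ; apply: negligibleS => x /= nQ /PQ. Qed.

Lemma ae_imply2 (R : realType) (P Q S : R -> Prop) :
  (forall x, P x -> Q x -> S x) ->
  {ae @mu R, forall x, P x} -> {ae @mu R, forall x, Q x} ->
    {ae @mu R, forall x, S x}.
Proof.
move=> PQ aP aQ; have := negligibleU aP aQ; apply: negligibleS => x /= nS.
by have [Px|] := pselect (P x); [right => /(PQ _ Px)|left].
Qed.

(** * The fundamental lemma of the calculus of variations *)

(** The primitive of [f], cut off outside [(c, d)], vanishes identically, and by
Lebesgue's differentiation theorem its derivative is [f] almost everywhere. *)
Lemma ae_eq0_itv (R : realType) (c d : R) (f : R -> R) : integrable_oo c d f ->
  (forall x, c < x <= d -> \int[mu]_(t in `]c, x[) f t = 0) ->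
  {ae mu, forall x, `]c, d[%classic x -> f x = 0}.
Proof.
move=> fi f0; pose g := f \_ `]c, d[.
have gT : mu.-integrable setT (EFin \o g).
  by rewrite -restrict_EFin; apply/integrable_restrict => //; rewrite setTI.
have G0 : (fun x : R => \int[mu]_(t in `]-oo, x]) g t) = fun=> 0.
  apply/funext => x; rewrite -Rintegral_mkcondr.
  have [xc|cx] := leP x c.
    rewrite (_ : _ `&` _ = set0) ?Rintegral_set0//.
    apply/seteqP; split=> // y [] /=; rewrite !in_itv/= => ? /andP[? ?]; lra.
  have [xd|dx] := ltP x d.
    rewrite (_ : _ `&` _ = `]c, x]%classic); last first.
      apply/seteqP; split=> y /=; rewrite !in_itv/=.
        by move=> [-> /andP[-> _]].
      by move=> /andP[cy yx]; split=> //; apply/andP; split=> //; lra.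
    rewrite -Rintegral_itv_bndo_bndc ?f0 ?cx ?(ltW xd)//.
    by apply: integrableS fi => //; apply: subset_itvl; rewrite bnd_simp ltW.
  have [cd|dc] := ltP c d; last first.
    rewrite (_ : _ `&` _ = set0) ?Rintegral_set0//.
    by apply/seteqP; split=> // y [] /=; rewrite !in_itv/= => ? /andP[? ?]; lra.
  rewrite (_ : _ `&` _ = `]c, d[%classic); last first.
    apply/seteqP; split=> y /=; rewrite !in_itv/=; first by case.
    by move=> /andP[cy yd]; rewrite cy yd; split=> //; lra.
  by rewrite f0// cd lexx.
have gl : locally_integrable setT g by apply: open_integrable_locally => //;
  exact: openT.
have gNy y : mu.-integrable `]-oo, y] (EFin \o g) by apply: integrableS gT.
have := FTC1Ny gNy gl; rewrite /= G0.
apply: filterS; first exact: (ae_filter_ringOfSetsType mu).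
move=> x [_]; rewrite derive1_cst => gx xcd.
by rewrite gx /g patchE mem_set.
Qed.

(** [(a, b)] is a countable union of intervals with closure in [(a, b)]. *)
Lemma ae_itv_oo (R : realType) (a b : R) (P : R -> Prop) :
  (forall c d, a < c -> c < d -> d < b ->
    {ae mu, forall x, `]c, d[%classic x -> P x}) ->
  {ae mu, forall x, `]a, b[%classic x -> P x}.
Proof.
move=> H; have [ab|ba] := ltP a b; last first.
  by apply: aeW => x /=; rewrite in_itv/= => /andP[? ?]; lra.
(* The denominator starts at 3 so that the margins [e n] on both sides leave a
   nonempty interval. *)
pose e n : R := (b - a) / (n.+3)%:R.
have H' n : {ae mu, forall x, `]a + e n, b - e n[%classic x -> P x}.
  have n0 : 0 < (n.+3)%:R^-1 :> R by rewrite invr_gt0.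
  have n1 : (n.+3)%:R^-1 <= 3^-1 :> R by rewrite lef_pV2 ?posrE// ler_nat.
  have ba0 : 0 < b - a by rewrite subr_gt0.
  have e0 : 0 < e n by rewrite mulr_gt0.
  have e1 : e n <= (b - a) / 3 by rewrite ler_pM2l.
  by apply: H; lra.
have := negligible_bigcup H'.
apply: negligibleS => x /= /not_implyP[]; rewrite in_itv/= => /andP[ax xb] nP.
have m0 : 0 < Num.min (x - a) (b - x) by rewrite lt_min !subr_gt0 ax.
set m := Num.min _ _ in m0.
pose n := Num.truncn ((b - a) / m).
exists n => //=; apply/not_implyP; split=> //.
have : e n < m.
  rewrite /e ltr_pdivrMr// mulrC -ltr_pdivrMr//.
  by apply: (lt_trans (truncnS_gt _)); rewrite ltr_nat.
by rewrite lt_min in_itv/= => /andP[? ?]; apply/andP; split; lra.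
Qed.

(** These test functions increase to the indicator of [(c, d)] when [n] tends
to infinity. *)
Lemma bump_family_test (R : realType) (a b c d : R) n : a < c -> c < d ->
  d < b ->
  test_function a b (fun x => 1 - (1 - bump c d x) ^+ n).
Proof.
move=> ac cd db; apply/test_functionP; first lra.
have s1 : smooth (fun x => 1 + -1 * bump c d x).
  by apply: smoothD; [exact: smooth_cst|apply: smoothM;
    [exact: smooth_cst|exact: smooth_bump]].
split.
  rewrite (_ : (fun _ => _) = fun x => 1 + -1 * (1 + -1 * bump c d x) ^+ n);
    last first.
    by apply/funext => x; rewrite !mulN1r.
  apply: smoothD; first exact: smooth_cst.
  by apply: smoothM; [exact: smooth_cst|exact: smoothX].
exists c, d; split=> //; first exact: ltW.
move=> x xcd; rewrite bump_eq0 ?subr0 ?expr1n ?subrr//.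
by apply: contra xcd => /andP[? ?]; apply/andP; split; exact: ltW.
Qed.

(** Testing with the functions of the previous lemma and letting [n] tend to
infinity gives [int_c^x f = 0] whenever [a < c < x < b]: the integrands are
dominated by [|f|] on [(c, x)], where [f] is integrable. *)
Lemma fundamental_lemma (R : realType) (a b : R) (f : R -> R) :
  locally_integrable `]a, b[ f ->
  (forall phi, test_function a b phi ->
    \int[mu]_(x in `]a, b[) (f x * phi x) = 0) ->
  {ae mu, forall x, `]a, b[%classic x -> f x = 0}.
Proof.
move=> lf H; apply: ae_itv_oo => c d ac cd db.
apply: ae_eq0_itv.
  by apply/integrable_oocc; exact: locint_integrable_cc lf.
move=> x /andP[cx xd].
have xb : x < b by lra.
pose phi n y := 1 - (1 - bump c x y) ^+ n.
have tphi n : test_function a b (phi n) by exact: bump_family_test.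
have sub : `]c, x[ `<=` `]a, b[.
  by move=> y; rewrite /= !in_itv/= => /andP[? ?]; apply/andP; split; lra.
have fcx : integrable_oo c x f by apply/integrable_oocc;
  exact: locint_integrable_cc lf.
have gi : mu.-integrable `]a, b[ (EFin \o (f \_ `]c, x[)).
  by rewrite -restrict_EFin; apply/integrable_restrict => //; rewrite setIidr.
have phi01 n y : 0 <= phi n y <= 1.
  have /andP[b0 b1] := bump_itv c x y.
  have h0 : 0 <= 1 - bump c x y by rewrite subr_ge0.
  rewrite /phi subr_ge0 exprn_ile1//=; last by rewrite lerBlDr lerDl.
  by rewrite lerBlDr lerDl exprn_ge0.
have phi0 n y : ~ `]c, x[%classic y -> phi n y = 0.
  by move=> /= /negP; rewrite in_itv/= /phi => /bump_eq0 ->;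
    rewrite subr0 expr1n subrr.
have phicvg y : `]c, x[%classic y -> phi ^~ y @ \oo --> (1 : R).
  rewrite /= in_itv/= -bump_gt0 => b0; have /andP[_ b1] := bump_itv c x y.
  rewrite -[X in _ --> X]subr0; apply: cvgB; first exact: cvg_cst.
  by apply: cvg_expr; rewrite ger0_norm ?subr_ge0// ltrBlDr ltrDl.
have ab : a < b by lra.
pose u n : R -> \bar R := EFin \o (fun y => f y * phi n y).
have mu_ n : measurable_fun `]a, b[ (u n) by exact: measurable_int
  (locint_test_integrable ab lf (tphi n)).
have ucvg : {ae mu, forall y, `]a, b[%classic y ->
  u ^~ y @ \oo --> (EFin \o (f \_ `]c, x[)) y}.
  apply: aeW => y _; apply: cvg_EFin; first exact: nearW.
  rewrite /comp /u /= patchE; case: ifPn => [/set_mem ycx|/negP ycx].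
    by rewrite -[X in _ --> X]mulr1; apply: cvgMr; exact: phicvg.
  rewrite (_ : (fun n => f y * phi n y) = fun=> 0); first exact: cvg_cst.
  by apply/funext => n; rewrite phi0 ?mulr0// => h; apply: ycx; exact/mem_set.
have udom : {ae mu, forall y n, `]a, b[%classic y ->
    (`|u n y| <= (abse \o (EFin \o (f \_ `]c, x[))) y)%E}.
  apply: aeW => y n _; rewrite /u /= lee_fin patchE;
    case: ifPn => [ycx|/negP ycx].
    have /andP[? ?] := phi01 n y.
    by rewrite normrM ler_piMr// ger0_norm.
  by rewrite phi0 ?mulr0 ?normr0// => h; apply: ycx; exact/mem_set.
have [_ _] := @dominated_convergence _ (measurableTypeR R) R mu `]a, b[%classic
  (measurable_itv _) u _ _ mu_ (measurable_int _ gi) ucvg (integrable_abse gi)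
    udom.
rewrite (_ : [sequence _]_n = fun=> 0%E); last first.
  apply/funext => n /=; rewrite -[LHS]fineK ?integrable_fin_num//;
    last exact: locint_test_integrable.
  by have := H _ (tphi n); rewrite /Rintegral => ->.
move=> /(cvg_lim (@ereal_hausdorff R)); rewrite lim_cst;
  last exact: ereal_hausdorff.
move=> /(congr1 fine) h; rewrite -(setIidr sub) Rintegral_mkcondr.
exact: esym.
Qed.

(** * Functionals vanishing on derivatives *)

(** A nonempty open interval is not negligible. *)
Lemma ae_itv_ex (R : realType) (a b : R) (P : R -> Prop) : a < b ->
  {ae mu, forall x, `]a, b[%classic x -> P x} ->
    exists2 x, `]a, b[%classic x & P x.
Proof.
move=> ab aeP; apply: contrapT => nP.
have : mu.-negligible `]a, b[.
  by apply: negligibleS aeP => x xab /(_ xab) Px; apply: nP; exists x.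
move=> neg; have E := @measure_negligible _ (measurableTypeR R) R mu _
  (measurable_itv _) neg.
have /eqP : mu (`]a, b[%classic : set R) = 0%E :> \bar R by exact: E.
by rewrite lebesgue_measure_itv/= lte_fin ab -EFinB eqe subr_eq0 gt_eqF.
Qed.

(** Otherwise the fundamental lemma would make the constant function 1
vanish. *)
Lemma test_int_neq0 (R : realType) (a b : R) : a < b ->
  exists2 phi, test_function a b phi & \int[mu]_(x in `]a, b[) phi x != 0.
Proof.
move=> ab; apply: contrapT => H.
have l1 : locally_integrable `]a, b[ (fun=> 1 : R).
  by apply: open_integrable_locally;
    [exact: interval_open|exact: cst_integrable_oo].
have := fundamental_lemma l1 _.
have H0 phi : test_function a b phi -> \int[mu]_(x in `]a, b[) (1 * phi x) = 0.
  move=> tphi; under eq_Rintegral do rewrite mul1r.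
  by apply: contrapT => /eqP I0; apply: H; exists phi.
move=> /(_ H0) /(ae_itv_ex ab)[x _ /eqP]; by rewrite oner_eq0.
Qed.

(** The antiderivative from [-oo] vanishes to the left of the support; to the
right of it, it is the total integral, which is 0. *)
Lemma test_antideriv (R : realType) (a b : R) (phi : R -> R) : a < b ->
  test_function a b phi -> \int[mu]_(x in `]a, b[) phi x = 0 ->
  exists2 Phi, test_function a b Phi & (Phi^`())%classic = phi.
Proof.
move=> ab tphi phi0.
have [sphi [c [d [ac cd db phi0']]]] := (test_functionP _ ab).1 tphi.
have cphi := smooth_continuous sphi.
have sub : `[c, d] `<=` `]a, b[.
  by move=> y; rewrite /= !in_itv/= => /andP[? ?]; apply/andP; split; lra.
have phiE : phi = phi \_ `[c, d].
  apply/funext => x; rewrite patchE; case: ifPn => // /negP xcd; apply: phi0'.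
  by apply/negP => ?; apply: xcd; rewrite mem_setE in_itv.
have iT : mu.-integrable setT (EFin \o phi).
  rewrite phiE -restrict_EFin; apply/integrable_restrict => //; rewrite setTI.
  apply: continuous_compact_integrable; first exact: segment_compact.
  exact: continuous_subspaceT.
pose Phi x := \int[mu]_(t in `]-oo, x]) phi t.
have dPhi (x : R) : is_derive x 1 Phi (phi x).
  have iu : mu.-integrable `]-oo, x + 1] (EFin \o phi) by apply: integrableS iT.
  have xx1 : x < x + 1 by rewrite ltrDl.
  have [dP PE] := @continuous_FTC1 R phi -oo%O x (x +
    1) xx1 iu (ltNyr _) (cphi x).
  by rewrite -PE derive1E; exact: derivableP.
have PhiE := derive1_fun dPhi.
exists Phi; last exact: PhiE.
apply/(test_functionP _ ab); split.
  move=> [|n] x; first by case: (dPhi x).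
  by rewrite /derive1n iterSr PhiE; exact: sphi.
exists c, d; split=> // x; rewrite negb_and -!ltNge => /orP[xc|dx].
  have -> : Phi x = \int[mu]_(t in `]-oo, x]) 0.
    apply: eq_Rintegral => t; rewrite inE/= in_itv/= => tx.
    by apply: phi0'; apply/negP => /andP[? ?]; lra.
  by rewrite Rintegral_cst// mul0r.
rewrite /Phi -phi0 phiE -!Rintegral_mkcondr; congr (Rintegral _ _ _).
rewrite [RHS]setIidr//; apply/setIidr => y /=; rewrite !in_itv/= => /andP[? ?];
  lra.
Qed.

Lemma testB (R : realType) (a b k : R) (phi psi : R -> R) : a < b ->
  test_function a b phi -> test_function a b psi ->
  test_function a b (fun x => phi x - k * psi x).
Proof.
move=> ab /(test_functionP _ ab)[s1 [c [d [ac cd db p0]]]].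
move=> /(test_functionP _ ab)[s2 [c' [d' [ac' cd' db' p0']]]].
apply/(test_functionP _ ab); split.
  rewrite (_ : (fun _ => _) = fun x => phi x + - k * psi x); last first.
    by apply/funext => x; rewrite mulNr.
  exact: (smoothD s1 (smoothM (smooth_cst _) s2)).
exists (Num.min c c'), (Num.max d d'); split=> //.
- by rewrite lt_min ac.
- by rewrite ge_min !le_max cd.
- by rewrite gt_max db.
move=> x; rewrite ge_min le_max => H.
rewrite p0 ?p0' ?mulr0 ?subr0//; apply: contra H => /andP[-> ->];
  by rewrite ?orbT.
Qed.

Lemma test_integrable (R : realType) (a b : R) (phi : R -> R) : a < b ->
  test_function a b phi -> integrable_oo a b phi.
Proof.
move=> ab tphi; apply/integrable_oocc; apply: continuous_compact_integrable;
  first exact: segment_compact.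
by apply: continuous_subspaceT; apply: smooth_continuous;
  case/(test_functionP _ ab): tphi.
Qed.

(** Fix a test function [phi0] with nonzero integral.  Every test function
differs from a multiple of [phi0] by one of integral zero, that is, by the
derivative of a test function, on which [T] vanishes. *)
Lemma functional_multiple_of_integral (R : realType) (a b : R)
    (T : (R -> R) -> R) : a < b ->
  (forall k phi psi, test_function a b phi -> test_function a b psi ->
    T (fun x => phi x - k * psi x) = T phi - k * T psi) ->
  (forall phi, test_function a b phi -> T (phi^`())%classic = 0) ->
  exists k, forall phi, test_function a b phi ->
    T phi = k * \int[mu]_(x in `]a, b[) phi x.
Proof.
move=> ab Tlin T0; have [phi0 t0 i0] := test_int_neq0 ab.
set I0 := (X in X != 0) in i0.
exists (T phi0 / I0) => phi tphi.
pose k := (\int[mu]_(x in `]a, b[) phi x) / I0.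
have tc := testB k ab tphi t0.
have c0 : \int[mu]_(x in `]a, b[) (phi x - k * phi0 x) = 0.
  have i1 := test_integrable ab tphi; have i2 := test_integrable ab t0.
  rewrite RintegralB//; last exact: integrable_ooZ.
  by rewrite RintegralZl// divfK// subrr.
(* [phi - k * phi0] has integral zero by the choice of [k]. *)
have [Phi tPhi PhiE] := test_antideriv ab tc c0.
have := T0 _ tPhi; rewrite PhiE Tlin// => /eqP; rewrite subr_eq0 => /eqP ->.
by rewrite /k mulrC mulrA mulrAC.
Qed.

(** * Absolutely continuous functions *)

(** [F] is absolutely continuous on the closed interval [[a, b]] with derivative
[f]. *)
Definition is_primitive (R : realType) (a b : R) (F f : R -> R) :=
  integrable_oo a b f /\
  forall x, a <= x <= b -> F x = F a + \int[mu]_(t in `]a, x[) f t.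

Lemma within_ext (R : realType) (a b : R) (f g : R -> R) :
  (forall x, a <= x <= b -> f x = g x) ->
  {within `[a, b], continuous f} -> {within `[a, b], continuous g}.
Proof.
move=> fg; apply: subspace_eq_continuous => x; rewrite inE/= in_itv/=;
  exact: fg.
Qed.

Lemma Rintegral_oo_empty (R : realType) (z : R) (f : R -> R) :
  \int[mu]_(t in `]z, z[) f t = 0.
Proof.
rewrite (_ : `]z, z[%classic = set0) ?Rintegral_set0//.
by apply/seteqP; split=> // u /=; rewrite in_itv/= => /andP[? ?]; lra.
Qed.

Lemma Rintegral_oocc (R : realType) (a b : R) (f : R -> R) :
  integrable_oo a b f ->
  \int[mu]_(t in `]a, b[) f t = \int[mu]_(t in `[a, b]) f t.
Proof.
move=> fi; congr fine; rewrite (@integral_itv_bndoo _ _ _ _ true false)//.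
exact: measurable_int fi.
Qed.

Lemma primitive_continuous (R : realType) (a b : R) (F f : R -> R) : a < b ->
  is_primitive a b F f -> {within `[a, b], continuous F}.
Proof.
move=> ab [fi FE].
have cI := parameterized_integral_continuous (ltW ab) ((integrable_oocc _ _
  _).1 fi).
have : {within `[a, b], continuous (fun x =>
  F a + parameterized_integral mu a x f)}.
  move=> x; apply: cvgD; [exact: cvg_cst|exact: cI].
apply: within_ext => x axb; rewrite (FE _ axb); congr +%R.
rewrite Rintegral_oocc//; apply: integrable_ooS fi => //; by case/andP: axb.
Qed.

Lemma primitive_integrable (R : realType) (a b : R) (F f : R -> R) : a < b ->
  is_primitive a b F f -> integrable_oo a b F.
Proof. by move=> ab /(primitive_continuous ab);
  exact: continuous_integrable_oo. Qed.

Lemma integral_primitive (R : realType) (a b : R) (f : R -> R) :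
  integrable_oo a b f ->
  is_primitive a b (fun x => \int[mu]_(t in `]a, x[) f t) f.
Proof. by move=> fi; split=> // x _; rewrite Rintegral_oo_empty add0r. Qed.

Lemma primitiveD_cst (R : realType) (a b k : R) (F f : R -> R) :
  is_primitive a b F f -> is_primitive a b (fun x => k + F x) f.
Proof. by move=> [fi FE]; split=> // x axb; rewrite (FE _ axb) addrA. Qed.

Lemma C1_primitive (R : realType) (a b : R) (F : R -> R) :
  (forall x : R, derivable F x 1) -> continuous (F^`())%classic ->
  is_primitive a b F (F^`())%classic.
Proof.
move=> dF cF; have cFw c d : {within `[c, d], continuous (F^`())%classic}.
  exact: continuous_subspaceT.
split; first exact: (continuous_integrable_oo (cFw a b)).
move=> x /andP[ax xb]; move: ax; rewrite le_eqVlt => /predU1P[->|ax].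
  by rewrite Rintegral_oo_empty addr0.
have cF0 (y : R) : {for y, continuous F}.
  by apply: differentiable_continuous; apply/derivable1_diffP.
rewrite (Rintegral_oocc (continuous_integrable_oo (cFw a x))).
rewrite /Rintegral (@continuous_FTC2 R (F^`())%classic F a x ax (cFw a x) _ _).
- by rewrite -EFinB /= addrC subrK.
- split; first by move=> y _; exact: dF.
  exact: cvg_at_right_filter (cF0 _).
exact: cvg_at_left_filter (cF0 _).
- by move=> y _.
Qed.

Lemma smooth_primitive (R : realType) (a b : R) (F : R -> R) : smooth F ->
  is_primitive a b F (F^`())%classic.
Proof.
move=> sF; apply: C1_primitive; first by move=> x; exact: smooth_derivable.
by apply: smooth_continuous; exact: smooth_derive1.
Qed.

(** Fubini's theorem on the half plane [t < x]. *)
Lemma triangle_fubini (R : realType) (g q : R -> R) :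
  mu.-integrable setT (EFin \o g) -> mu.-integrable setT (EFin \o q) ->
  \int[mu]_x (q x * \int[mu]_(t in `]-oo, x[) g t) =
  \int[mu]_t (g t * \int[mu]_(x in `]t, +oo[) q x).
Proof.
move=> gi qi.
have mg : measurable_fun setT g by apply/measurable_EFinP;
  exact: measurable_int gi.
have mq : measurable_fun setT q by apply/measurable_EFinP;
  exact: measurable_int qi.
(* The integrand on the half plane, extended by zero; it is dominated by the
   product of [|q|] and [|g|]. *)
pose h (z : measurableTypeR R * measurableTypeR R) : \bar R :=
  (if z.2 < z.1 then q z.1 * g z.2 else 0)%:E.
have mh : measurable_fun setT h.
  apply/measurable_EFinP; apply: measurable_fun_ifT.
  - by apply: measurable_fun_ltr.
  - by apply: measurable_funM; exact: measurableT_comp.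
  - exact: measurable_cst.
have meq : measurable_fun setT (fun x : measurableTypeR R => `|(q x)%:E|%E).
  by apply: measurableT_comp => //; exact/measurable_EFinP.
have meg : measurable_fun setT (fun x : measurableTypeR R => `|(g x)%:E|%E).
  by apply: measurableT_comp => //; exact/measurable_EFinP.
have hi : (mu \x mu)%E.-integrable setT h.
  apply/(integrable12ltyP mu mu mh).
  pose K := (\int[mu]_y `|(g y)%:E|)%E.
  have K0 : (0 <= K)%E by apply: integral_ge0.
  have KE : K = (fine K)%:E by rewrite fineK// ge0_fin_numE//;
    case/integrableP: gi.
  have k0 : 0 <= fine K by exact: fine_ge0.
  apply: (@le_lt_trans _ _ (\int[mu]_x (`|(q x)%:E| * (fine K)%:E))%E).
    apply: ge0_le_integral => //.
    - by move=> x _; exact: integral_ge0.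
    - apply: (measurable_fun_fubini_tonelli_F (abse \o h)).
        exact: measurableT_comp.
      by move=> z; exact: abse_ge0.
    - exact: emeasurable_funM.
    - move=> x _; rewrite -KE -ge0_integralZl//.
      apply: ge0_le_integral => //.
      + apply: measurableT_comp => //;
        exact: (measurableT_comp mh (measurable_pair1 x)).
      + exact: emeasurable_funM.
      + move=> y _; rewrite /h /= -EFinM lee_fin; case: ifP => _.
          by rewrite normrM.
        by rewrite normr0 mulr_ge0.
  rewrite ge0_integralZr//.
  by rewrite muleC; apply: lte_mul_pinfty => //; case/integrableP: qi.
have E1 : (fun x => \int[mu]_y h (x, y))%E =
    EFin \o (fun x => q x * \int[mu]_(t in `]-oo, x[) g t).
  apply/funext => x /=.
  have gx : mu.-integrable `]-oo, x[ (EFin \o g) by apply: integrableS gi.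
  rewrite EFinM fineK; last exact: integrable_fin_num.
  rewrite -integralZl// [RHS]integral_mkcond; apply: eq_integral => y _.
  rewrite /h patchE mem_setE in_itv/=; by case: ifP.
have E2 : (fun y => \int[mu]_x h (x, y))%E =
    EFin \o (fun t => g t * \int[mu]_(x in `]t, +oo[) q x).
  apply/funext => y /=.
  have qy : mu.-integrable `]y, +oo[ (EFin \o q) by apply: integrableS qi.
  rewrite EFinM fineK; last exact: integrable_fin_num.
  rewrite -integralZl// [RHS]integral_mkcond; apply: eq_integral => x _.
  rewrite /h patchE mem_setE in_itv/= andbT; case: ifP => // _.
  by rewrite mulrC.
have := Fubini hi; rewrite E1 E2 => /(congr1 fine); exact.
Qed.

(** The previous lemma for functions supported in [(a, b)]. *)
Lemma primitive_fubini (R : realType) (a b : R) (f p : R -> R) :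
  integrable_oo a b f -> integrable_oo a b p ->
  \int[mu]_(x in `]a, b[) (p x * \int[mu]_(t in `]a, x[) f t) =
  \int[mu]_(t in `]a, b[) (f t * \int[mu]_(x in `]t, b[) p x).
Proof.
move=> fi pi.
have iT k : integrable_oo a b k -> mu.-integrable setT (EFin \o (k \_ `]a, b[)).
  by move=> ki; rewrite -restrict_EFin; apply/integrable_restrict => //;
    rewrite setTI.
have := triangle_fubini (iT _ fi) (iT _ pi).
have patchM (k : R -> R) (l : R -> R) (m : R -> R) :
   (forall x, `]a, b[%classic x -> l x = m x) ->
   (fun x => (k \_ `]a, b[) x * l x) = (fun x => k x * m x) \_ `]a, b[.
  move=> lm; apply/funext => x; rewrite !patchE;
    case: ifPn => [/set_mem /lm ->//|_].
  exact: mul0r.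
rewrite (patchM p _ (fun x => \int[mu]_(t in `]a, x[) f t)); last first.
  move=> x /=; rewrite in_itv/= => /andP[ax xb].
  rewrite -Rintegral_mkcondr; congr Rintegral.
  apply/seteqP; split=> y /=; rewrite !in_itv/=;
    first by move=> [-> /andP[-> _]].
  by move=> /andP[-> yx]; rewrite yx (lt_trans yx xb).
rewrite (patchM f _ (fun x => \int[mu]_(t in `]x, b[) p t)); last first.
  move=> x /=; rewrite in_itv/= => /andP[ax xb].
  rewrite -Rintegral_mkcondr; congr Rintegral.
  apply/seteqP; split=> y /=; rewrite !in_itv/= ?andbT;
    first by move=> [-> /andP[_ ->]].
  by move=> /andP[xy ->]; rewrite xy (lt_trans ax xy).
by rewrite -!Rintegral_mkcond.
Qed.

Lemma primitive_itv (R : realType) (a b x y : R) (F f : R -> R) :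
  is_primitive a b F f ->
  a <= x -> x <= y -> y <= b -> \int[mu]_(t in `]x, y[) f t = F y - F x.
Proof.
move=> [fi FE] ax xy yb.
rewrite (FE y) ?(le_trans ax)//= (FE x) ?ax ?(le_trans xy)//=.
move: ax; rewrite le_eqVlt => /predU1P[<-|ax];
  first by rewrite Rintegral_oo_empty; ring.
move: xy; rewrite le_eqVlt => /predU1P[<-|xy];
  first by rewrite Rintegral_oo_empty; ring.
have fy : integrable_oo a y f by apply: integrable_ooS fi.
have fx : integrable_oo a x f by apply: integrable_ooS fy => //; exact: ltW.
have := @Rintegral_itvB R f (BRight a) (BLeft y) x fy.
rewrite !bnd_simp -Rintegral_itv_bndo_bndc// => /(_ (ltW ax) xy) <-.
by ring.
Qed.

(** The inner integrals in [primitive_fubini] are [F x - F a] and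
[P b - P t]. *)
Lemma primitive_parts (R : realType) (a b : R) (F f P p : R -> R) : a < b ->
  is_primitive a b F f -> is_primitive a b P p ->
  \int[mu]_(x in `]a, b[) (f x * P x) =
  F b * P b - F a * P a - \int[mu]_(x in `]a, b[) (F x * p x).
Proof.
move=> ab Ff Pp; have := primitive_fubini Ff.1 Pp.1.
have iF := primitive_itv Ff; have iP := primitive_itv Pp.
have Fb := iF _ _ (lexx a) (ltW ab) (lexx b).
have Pb := iP _ _ (lexx a) (ltW ab) (lexx b).
have pF : integrable_oo a b (fun x => F x * p x).
  have := integrable_ooM Pp.1 (primitive_continuous ab Ff).
  by apply: eq_integrable => // x _ /=; rewrite mulrC.
have fP := integrable_ooM Ff.1 (primitive_continuous ab Pp).
have -> : \int[mu]_(x in `]a, b[) (p x * \int[mu]_(t in `]a, x[) f t) =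
    \int[mu]_(x in `]a, b[) (F x * p x - F a * p x).
  apply: eq_Rintegral => x; rewrite inE/= in_itv/= => /andP[ax xb].
  by rewrite (iF a x (lexx a) (ltW ax) (ltW xb)) mulrBr !(mulrC (p x)).
have -> : \int[mu]_(t in `]a, b[) (f t * \int[mu]_(x in `]t, b[) p x) =
    \int[mu]_(x in `]a, b[) (P b * f x - f x * P x).
  apply: eq_Rintegral => x; rewrite inE/= in_itv/= => /andP[ax xb].
  by rewrite (iP x b (ltW ax) (ltW xb) (lexx b)) mulrBr (mulrC _ (P b)).
rewrite RintegralB//; last exact: (integrable_ooZ _ Pp.1).
rewrite RintegralB//; last exact: (integrable_ooZ _ Ff.1).
rewrite !RintegralZl ?Fb ?Pb//; [|exact: Ff.1|exact: Pp.1].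
by lra.
Qed.

Lemma test_primitive (R : realType) (a b : R) (phi : R -> R) : a < b ->
  test_function a b phi ->
    [/\ is_primitive a b phi (phi^`())%classic, phi a = 0 & phi b = 0].
Proof.
move=> ab /(test_functionP _ ab)[sphi [c [d [ac cd db phi0]]]]; split.
- exact: smooth_primitive.
- by apply: phi0; apply/negP => /andP[? ?]; lra.
- by apply: phi0; apply/negP => /andP[? ?]; lra.
Qed.

Lemma primitive_test (R : realType) (a b : R) (F f phi : R -> R) : a < b ->
  is_primitive a b F f -> test_function a b phi ->
  \int[mu]_(x in `]a, b[) (F x * (phi^`())%classic x) =
  - \int[mu]_(x in `]a, b[) (f x * phi x).
Proof.
move=> ab Ff /(test_primitive ab)[pp pa pb].
by rewrite (primitive_parts ab Ff pp) pa pb; ring.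
Qed.

(** * Weak derivatives of real functions *)

Definition is_real_wderiv (R : realType) (a b : R) (k : nat) (f g : R -> R) :=
  [/\ locally_integrable `]a, b[ f, locally_integrable `]a, b[ g &
      forall phi : R -> R, test_function a b phi ->
        \int[mu]_(x in `]a, b[) (f x * (phi^`(k))%classic x) =
        (-1) ^+ k * \int[mu]_(x in `]a, b[) (g x * phi x)].

Lemma test_derive1n (R : realType) (a b : R) k (phi : R -> R) : a < b ->
  test_function a b phi -> test_function a b (phi^`(k))%classic.
Proof. by move=> ab tphi; elim: k => //= k IH; exact: test_derive1. Qed.

Lemma real_wderiv_uniq (R : realType) (a b : R) k (f g h : R -> R) : a < b ->
  is_real_wderiv a b k f g -> is_real_wderiv a b k f h ->
  {ae mu, forall x, `]a, b[%classic x -> g x = h x}.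
Proof.
move=> ab [lf lg fg] [_ lh fh].
have : {ae mu, forall x, `]a, b[%classic x -> g x - h x = 0}.
  apply: fundamental_lemma; first exact: locally_integrableB.
  move=> phi tphi.
  have gp := locint_test_integrable ab lg tphi;
    have hp := locint_test_integrable ab lh tphi.
  under eq_Rintegral do rewrite mulrBl.
  rewrite RintegralB//.
  have := fg _ tphi; rewrite fh// => /eqP.
  by rewrite (inj_eq (mulfI _)) ?signr_eq0// => /eqP ->; rewrite subrr.
apply: ae_imply => x H xab; apply/eqP; rewrite -subr_eq0; apply/eqP; exact: H.
Qed.

(** The functional [phi |-> int f phi] vanishes on derivatives, so it is a
multiple of the integral; the fundamental lemma applies to [f - k]. *)
Lemma du_bois_reymond (R : realType) (a b : R) (f : R -> R) : a < b ->
  locally_integrable `]a, b[ f ->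
  (forall phi, test_function a b phi ->
    \int[mu]_(x in `]a, b[) (f x * (phi^`())%classic x) = 0) ->
  exists k, {ae mu, forall x, `]a, b[%classic x -> f x = k}.
Proof.
move=> ab lf f0.
pose T phi := \int[mu]_(x in `]a, b[) (f x * phi x).
have Tlin k phi psi : test_function a b phi -> test_function a b psi ->
    T (fun x => phi x - k * psi x) = T phi - k * T psi.
  move=> tphi tpsi.
  have i1 := locint_test_integrable ab lf tphi;
    have i2 := locint_test_integrable ab lf tpsi.
  rewrite /T -RintegralZl// -RintegralB//; last exact: integrable_ooZ.
  by apply: eq_Rintegral => x _; ring.
have [k Tk] := functional_multiple_of_integral ab Tlin f0; exists k.
have lk : locally_integrable `]a, b[ (fun=> k).
  by apply: open_integrable_locally;
    [exact: interval_open|exact: cst_integrable_oo].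
have : {ae mu, forall x, `]a, b[%classic x -> f x - k = 0}.
  apply: fundamental_lemma; first exact: locally_integrableB.
  move=> phi tphi.
  have gp := locint_test_integrable ab lf tphi;
    have hp := locint_test_integrable ab lk tphi.
  under eq_Rintegral do rewrite mulrBl.
  rewrite RintegralB// -/(T phi) Tk// RintegralZl ?subrr//.
  exact: test_integrable.
apply: ae_imply => x H xab; apply/eqP; rewrite -subr_eq0; apply/eqP; exact: H.
Qed.

Lemma integrable_locint (R : realType) (a b : R) (f : R -> R) :
  integrable_oo a b f -> locally_integrable `]a, b[ f.
Proof. by move=> fi; apply: open_integrable_locally => //;
  exact: interval_open. Qed.

(** An integrable weak derivative makes [f] absolutely continuous: [f] minus a
primitive of [g] has zero weak derivative. *)
Lemma real_wderiv1_primitive (R : realType) (a b : R) (f g : R -> R) : a < b ->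
  is_real_wderiv a b 1 f g -> integrable_oo a b g ->
  exists2 F, is_primitive a b F g &
    {ae mu, forall x, `]a, b[%classic x -> f x = F x}.
Proof.
move=> ab [lf lg fg] gi.
have [G G0] : exists G, is_primitive a b G g.
  by exists (fun x => \int[mu]_(t in `]a, x[) g t); exact: integral_primitive.
have lG := integrable_locint (primitive_integrable ab G0).
have [k fk] : exists k, {ae mu, forall x, `]a, b[%classic x -> (f \- G) x = k}.
  apply: du_bois_reymond => //; first exact: locally_integrableB.
  move=> phi tphi.
  have tphi' := test_derive1 ab tphi.
  have gp := locint_test_integrable ab lf tphi';
    have hp := locint_test_integrable ab lG tphi'.
  under eq_Rintegral do rewrite mulrBl.
  rewrite RintegralB// (primitive_test ab G0 tphi).
  by have := fg _ tphi; rewrite /= => ->; rewrite expr1 mulN1r subrr.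
exists (fun x => k + G x); first exact: primitiveD_cst.
by apply: ae_imply fk => x H xab; rewrite -(H xab) /= subrK.
Qed.

(** An integrable second weak derivative forces the first one to exist.  If
[G] is a primitive of [g], the functional [phi |-> int f phi' + int G phi]
vanishes on derivatives, because [int G phi' = - int g phi]; so it is
[k * int phi], and [G - k] is the first weak derivative of [f]. *)
Lemma real_wderiv2_primitive (R : realType) (a b : R) (f g : R -> R) : a < b ->
  is_real_wderiv a b 2 f g -> integrable_oo a b g ->
  exists G, is_primitive a b G g /\ is_real_wderiv a b 1 f G.
Proof.
move=> ab [lf lg fg] gi.
have [G G0] : exists G, is_primitive a b G g.
  by exists (fun x => \int[mu]_(t in `]a, x[) g t); exact: integral_primitive.
have lG := integrable_locint (primitive_integrable ab G0).
pose T phi := \int[mu]_(x in `]a, b[) (f x * (phi^`())%classic x) +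
  \int[mu]_(x in `]a, b[) (G x * phi x).
have Tlin k phi psi : test_function a b phi -> test_function a b psi ->
    T (fun x => phi x - k * psi x) = T phi - k * T psi.
  move=> tphi tpsi.
  have i1 := locint_test_integrable ab lG tphi;
    have i2 := locint_test_integrable ab lG tpsi.
  have i3 := locint_test_integrable ab lf (test_derive1 ab tphi).
  have i4 := locint_test_integrable ab lf (test_derive1 ab tpsi).
  have dE : ((fun x : R => phi x - k * psi x)^`())%classic =
      (fun x => (phi^`())%classic x - k * (psi^`())%classic x).
    apply: derive1_fun => x.
    have dphi := is_derive1_smooth x ((test_functionP _ ab).1 tphi).1.
    have dpsi := is_derive1_smooth x ((test_functionP _ ab).1 tpsi).1.
    exact: (is_deriveB dphi (is_deriveZ k dpsi)).
  rewrite /T dE.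
  rewrite mulrDr -!RintegralZl//.
  rewrite opprD addrACA -!RintegralB//;
    [|exact: integrable_ooZ|exact: integrable_ooZ].
  by congr (_ + _); apply: eq_Rintegral => x _; ring.
have [k Tk] : exists k, forall phi, test_function a b phi ->
  T phi = k * \int[mu]_(x in `]a, b[) phi x.
  apply: functional_multiple_of_integral => // phi tphi;
    rewrite /T (primitive_test ab G0 tphi).
  have := fg _ tphi; rewrite /= => ->.
  by rewrite sqrrN expr1n mul1r subrr.
have Gk := primitiveD_cst (- k) G0.
exists (fun x => - k + G x); split=> //; split=> //.
  exact: integrable_locint (primitive_integrable ab Gk).
move=> phi tphi; rewrite expr1 mulN1r.
have i1 := locint_test_integrable ab lG tphi;
  have i2 := test_integrable ab tphi.
have -> : \int[mu]_(x in `]a, b[) ((- k + G x) * phi x) =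
    \int[mu]_(x in `]a, b[) (G x * phi x) - k * \int[mu]_(x in `]a, b[) phi x.
  rewrite -RintegralZl// -RintegralB//; last exact: integrable_ooZ.
  by apply: eq_Rintegral => x _; rewrite addrC mulrBl.
by rewrite -Tk// /T; set A := Rintegral _ _ _; set B := Rintegral _ _ _; ring.
Qed.

Local Open Scope complex_scope.

(** * Weak derivatives of complex functions *)

Lemma ReMr (R : realType) (z : R[i]) (r : R) :
  complex.Re (z * r%:C) = complex.Re z * r.
Proof. by case: z => a b /=; rewrite mulr0 subr0. Qed.

Lemma ImMr (R : realType) (z : R[i]) (r : R) :
  complex.Im (z * r%:C) = complex.Im z * r.
Proof. by case: z => a b /=; rewrite mulr0 add0r. Qed.

Lemma ReD (R : realType) (z w : R[i]) :
  complex.Re (z + w) = complex.Re z + complex.Re w.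
Proof. by case: z w => [? ?] [? ?]. Qed.

Lemma ImD (R : realType) (z w : R[i]) :
  complex.Im (z + w) = complex.Im z + complex.Im w.
Proof. by case: z w => [? ?] [? ?]. Qed.

Lemma ReN (R : realType) (z : R[i]) : complex.Re (- z) = - complex.Re z.
Proof. by case: z. Qed.

Lemma ImN (R : realType) (z : R[i]) : complex.Im (- z) = - complex.Im z.
Proof. by case: z. Qed.

Lemma complex_eq (R : realType) (z w : R[i]) :
  complex.Re z = complex.Re w -> complex.Im z = complex.Im w -> z = w.
Proof. by case: z w => [a b] [c d] /= -> ->. Qed.

Lemma signC (R : realType) k : (-1) ^+ k = ((-1) ^+ k)%:C :> R[i].
Proof. by rewrite rmorphXn rmorphN1. Qed.

Lemma Re_cintegral (R : realType) (a b : R) (f : R -> R[i]) (p : R -> R) :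
  complex.Re (cintegral a b (fun x => f x * (p x)%:C)) =
  \int[mu]_(x in `]a, b[) (complex.Re (f x) * p x).
Proof. by apply: eq_Rintegral => x _; rewrite ReMr. Qed.

Lemma Im_cintegral (R : realType) (a b : R) (f : R -> R[i]) (p : R -> R) :
  complex.Im (cintegral a b (fun x => f x * (p x)%:C)) =
  \int[mu]_(x in `]a, b[) (complex.Im (f x) * p x).
Proof. by apply: eq_Rintegral => x _; rewrite ImMr. Qed.

Lemma is_wderivP (R : realType) (a b : R) k (f g : R -> R[i]) :
  is_wderiv a b k f g <->
  is_real_wderiv a b k (fun x => complex.Re (f x)) (fun x =>
    complex.Re (g x)) /\
  is_real_wderiv a b k (fun x => complex.Im (f x)) (fun x => complex.Im (g x)).
Proof.
split=> [[[rf jf] [rg jg] fg]|[[rf rg fg1] [jf jg fg2]]].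
  split; split=> // phi /fg; rewrite signC mulrC => E.
    by rewrite -Re_cintegral E ReMr Re_cintegral mulrC.
  by rewrite -Im_cintegral E ImMr Im_cintegral mulrC.
split=> // phi tphi; rewrite signC mulrC; apply: complex_eq.
  by rewrite Re_cintegral ReMr Re_cintegral fg1// mulrC.
by rewrite Im_cintegral ImMr Im_cintegral fg2// mulrC.
Qed.

Definition ae_eq_oo (R : realType) (a b : R) (f g : R -> R[i]) :=
  {ae @mu R, forall x, `]a, b[%classic x -> f x = g x}.

Definition cintegrable_oo (R : realType) (a b : R) (f : R -> R[i]) :=
  integrable_oo a b (fun x => complex.Re (f x)) /\
    integrable_oo a b (fun x => complex.Im (f x)).

Definition cmeasurable_oo (R : realType) (a b : R) (f : R -> R[i]) :=
  measurable_fun `]a, b[ (fun x => complex.Re (f x)) /\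
  measurable_fun `]a, b[ (fun x => complex.Im (f x)).

Definition is_cprimitive (R : realType) (a b : R) (F f : R -> R[i]) :=
  is_primitive a b (fun x => complex.Re (F x)) (fun x => complex.Re (f x)) /\
  is_primitive a b (fun x => complex.Im (F x)) (fun x => complex.Im (f x)).

Lemma ae_eq_oo_parts (R : realType) (a b : R) (f g : R -> R[i]) :
  {ae @mu R, forall x, `]a, b[%classic x ->
    complex.Re (f x) = complex.Re (g x)} ->
  {ae @mu R, forall x, `]a, b[%classic x ->
    complex.Im (f x) = complex.Im (g x)} ->
  ae_eq_oo a b f g.
Proof.
by apply: ae_imply2 => x Hr Hi xab; apply: complex_eq; [exact: Hr|exact: Hi].
Qed.

Lemma ae_eq_oo_trans (R : realType) (a b : R) (f g h : R -> R[i]) :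
  ae_eq_oo a b f g -> ae_eq_oo a b g h -> ae_eq_oo a b f h.
Proof. by apply: ae_imply2 => x H K xab; rewrite H// K. Qed.

Lemma wderiv_uniq (R : realType) (a b : R) k (f g h : R -> R[i]) : a < b ->
  is_wderiv a b k f g -> is_wderiv a b k f h -> ae_eq_oo a b g h.
Proof.
move=> ab /is_wderivP[rg ig] /is_wderivP[rh ih].
by apply: ae_eq_oo_parts;
  [exact: real_wderiv_uniq rg rh|exact: real_wderiv_uniq ig ih].
Qed.

(** Test with the [k]-th derivative of a test function. *)
Lemma real_wderiv_sub (R : realType) (a b : R) j k (f g h : R -> R) : a < b ->
  is_real_wderiv a b j f g -> is_real_wderiv a b (j + k) f h ->
    is_real_wderiv a b k g h.
Proof.
move=> ab [lf lg fg] [_ lh fh]; split=> // phi tphi.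
have := fh _ tphi; rewrite {1}/derive1n iterD -/(derive1n _ _) -/(derive1n _ _).
rewrite (fg _ (test_derive1n k ab tphi)) exprD -mulrA.
by move/(mulfI _); apply; rewrite signr_eq0.
Qed.

Lemma real_wderivD (R : realType) (a b : R) j k (f g h : R -> R) : a < b ->
  is_real_wderiv a b j f g -> is_real_wderiv a b k g h ->
    is_real_wderiv a b (j + k) f h.
Proof.
move=> ab [lf lg fg] [_ lh gh]; split=> // phi tphi.
rewrite {1}/derive1n iterD -/(derive1n _ _) -/(derive1n _ _).
by rewrite (fg _ (test_derive1n k ab tphi)) exprD -mulrA gh.
Qed.

Lemma wderiv_sub (R : realType) (a b : R) j k (f g h : R -> R[i]) : a < b ->
  is_wderiv a b j f g -> is_wderiv a b (j + k) f h -> is_wderiv a b k g h.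
Proof.
move=> ab /is_wderivP[rg ig] /is_wderivP[rh ih]; apply/is_wderivP.
by split; [exact: real_wderiv_sub rg rh|exact: real_wderiv_sub ig ih].
Qed.

Lemma wderivD (R : realType) (a b : R) j k (f g h : R -> R[i]) : a < b ->
  is_wderiv a b j f g -> is_wderiv a b k g h -> is_wderiv a b (j + k) f h.
Proof.
move=> ab /is_wderivP[rg ig] /is_wderivP[rh ih]; apply/is_wderivP.
by split; [exact: real_wderivD rg rh|exact: real_wderivD ig ih].
Qed.

Lemma wderiv1_primitive (R : realType) (a b : R) (f g : R -> R[i]) : a < b ->
  is_wderiv a b 1 f g -> cintegrable_oo a b g ->
    exists2 F, is_cprimitive a b F g & ae_eq_oo a b f F.
Proof.
move=> ab /is_wderivP[rg ig] [gr gi].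
have [F1 F1p F1E] := real_wderiv1_primitive ab rg gr.
have [F2 F2p F2E] := real_wderiv1_primitive ab ig gi.
by exists (fun x => F1 x +i* F2 x) => //; exact: ae_eq_oo_parts.
Qed.

Lemma wderiv2_primitive (R : realType) (a b : R) (f g : R -> R[i]) : a < b ->
  is_wderiv a b 2 f g -> cintegrable_oo a b g ->
    exists2 G, is_cprimitive a b G g & is_wderiv a b 1 f G.
Proof.
move=> ab /is_wderivP[rg ig] [gr gi].
have [G1 [G1p G1E]] := real_wderiv2_primitive ab rg gr.
have [G2 [G2p G2E]] := real_wderiv2_primitive ab ig gi.
by exists (fun x => G1 x +i* G2 x) => //; exact/is_wderivP.
Qed.

Lemma cintegrable_measurable (R : realType) (a b : R) (f : R -> R[i]) :
  cintegrable_oo a b f -> cmeasurable_oo a b f.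
Proof. by move=> [f1 f2]; split; apply/measurable_EFinP;
  [exact: measurable_int f1|exact: measurable_int f2]. Qed.

Lemma cintegrableZ (R : realType) (a b c : R) (f : R -> R[i]) :
  cintegrable_oo a b f -> cintegrable_oo a b (fun x => c%:C * f x).
Proof.
move=> [f1 f2]; split.
  have := integrable_ooZ c f1; apply: eq_integrable => // x _ /=.
  by rewrite [in RHS]mulrC ReMr mulrC.
have := integrable_ooZ c f2; apply: eq_integrable => // x _ /=.
by rewrite [in RHS]mulrC ImMr mulrC.
Qed.

Lemma cintegrableD (R : realType) (a b : R) (f g : R -> R[i]) :
  cintegrable_oo a b f -> cintegrable_oo a b g ->
    cintegrable_oo a b (fun x => f x + g x).
Proof.
move=> [f1 f2] [g1 g2]; split.
  by have := integrable_ooD f1 g1; apply: eq_integrable => // x _ /=;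
    case: (f x) (g x) => [? ?] [? ?].
by have := integrable_ooD f2 g2; apply: eq_integrable => // x _ /=;
  case: (f x) (g x) => [? ?] [? ?].
Qed.

Lemma cmeasurableD (R : realType) (a b : R) (f g : R -> R[i]) :
  cmeasurable_oo a b f -> cmeasurable_oo a b g ->
    cmeasurable_oo a b (fun x => f x + g x).
Proof.
move=> [f1 f2] [g1 g2]; split.
  have := measurable_funD f1 g1.
  by apply: eq_measurable_fun => x _ /=; case: (f x) (g x) => [? ?] [? ?].
have := measurable_funD f2 g2.
by apply: eq_measurable_fun => x _ /=; case: (f x) (g x) => [? ?] [? ?].
Qed.

Lemma ae_eq_oo_refl (R : realType) (a b : R) (f : R -> R[i]) : ae_eq_oo a b f f.
Proof. exact: aeW. Qed.

Lemma wderiv_measurable (R : realType) (a b : R) k (f g : R -> R[i]) :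
  is_wderiv a b k f g -> cmeasurable_oo a b g.
Proof. by move=> [_ [[m1 _ _] [m2 _ _]] _]. Qed.

(** On a bounded interval [|t| <= 1 + t ^ 2] is enough. *)
Lemma inL2_cintegrable (R : realType) (a b : R) (f : R -> R[i]) :
  inL2 a b f -> cintegrable_oo a b f.
Proof.
move=> [m1 m2 fi].
have i1 : mu.-integrable `]a, b[ (EFin \o (fun x =>
  1 + (complex.Re (f x) ^+ 2 + complex.Im (f x) ^+ 2))).
  by apply: (@integrable_ooD _ a b (fun=> 1)) => //; exact: cst_integrable_oo.
have dom (t : R) x : t ^+ 2 <= complex.Re (f x) ^+ 2 + complex.Im (f x) ^+ 2 ->
    `|t| <= `|1 + (complex.Re (f x) ^+ 2 + complex.Im (f x) ^+ 2)|.
  move=> tx; rewrite [leRHS]ger0_norm; last by rewrite !addr_ge0// sqr_ge0.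
  by rewrite -(real_normK (num_real t)) in tx; nra.
split; apply: le_integrable i1 => //; try exact/measurable_EFinP.
  by move=> x _ /=; rewrite lee_fin; apply: dom; rewrite lerDl sqr_ge0.
by move=> x _ /=; rewrite lee_fin; apply: dom; rewrite lerDr sqr_ge0.
Qed.

Lemma cont_inL2 (R : realType) (a b : R) (f : R -> R[i]) :
  {within `[a, b], continuous (fun x => complex.Re (f x))} ->
  {within `[a, b], continuous (fun x => complex.Im (f x))} -> inL2 a b f.
Proof.
move=> cr ci.
have [m1 m2] := cintegrable_measurable (conj (continuous_integrable_oo cr)
  (continuous_integrable_oo ci)).
split=> //; apply: continuous_integrable_oo => x; apply: cvgD.
  by rewrite !expr2; apply: cvgM; exact: cr.
by rewrite !expr2; apply: cvgM; exact: ci.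
Qed.

Lemma cprimitive_continuous (R : realType) (a b : R) (F f : R -> R[i]) :
  a < b -> is_cprimitive a b F f ->
  {within `[a, b], continuous (fun x => complex.Re (F x))} /\
  {within `[a, b], continuous (fun x => complex.Im (F x))}.
Proof. by move=> ab [r i]; split;
  [exact: primitive_continuous r|exact: primitive_continuous i]. Qed.

Lemma wderivP (R : realType) (a b : R) k (f : R -> R[i]) :
  wderiv_inL2 a b k f ->
  is_wderiv a b k f (wderiv a b k f).
Proof. by move=> [g [fg _]]; apply: (xgetPex (fun=> 0)); exists g. Qed.

(** * Pointwise values *)

(** Every neighbourhood of [c] in [[a, b]] contains an open interval, hence a
zero of [h]; this covers the endpoints [c = a] and [c = b]. *)
Lemma cont_ae_eq0 (R : realType) (a b c : R) (h : R -> R) :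
  a < b -> a <= c <= b ->
  {within `[a, b], continuous h} ->
  {ae @mu R, forall x, `]a, b[%classic x -> h x = 0} -> h c = 0.
Proof.
move=> ab acb ch h0; apply/eqP; rewrite -normr_le0; apply/ler_addgt0Pl => e e0.
rewrite addr0.
have /subspace_continuousP/(_ c) := ch.
rewrite /= in_itv/= => /(_ acb) /cvgrPdist_le/(_ e e0) [d /= d0 hd].
have [x] : exists2 x, `]Num.max a (c - d), Num.min b (c + d)[%classic x & h x =
  0.
  apply: ae_itv_ex.
    by rewrite gt_max !lt_min ab; case/andP: acb => ? ?; apply/andP; split;
      apply/andP; split; lra.
  apply: ae_imply h0 => x H /=;
    rewrite in_itv/= gt_max lt_min => /andP[/andP[ax _] /andP[xb _]].
  by apply: H; rewrite /= in_itv/= ax.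
rewrite /= in_itv/= gt_max lt_min => /andP[/andP[ax cx] /andP[xb xc]] hx.
move: (hd x); rewrite /from_subspace hx subr0; apply.
  by rewrite /ball/= ltr_norml; apply/andP; split; lra.
by rewrite in_itv/= !ltW.
Qed.

(** Two representatives continuous on the closed interval agree everywhere on
it, so the chosen one may be replaced by any other. *)
Lemma pval_eq (R : realType) (a b c : R) (f g : R -> R[i]) :
  a < b -> a <= c <= b ->
  continuous_rep a b f g -> pval a b f c = g c.
Proof.
move=> ab acb gP; rewrite /pval.
have [h1 h2 h3] : continuous_rep a b f (xget (fun=>
  0) [set g | continuous_rep a b f g]).
  by apply: (xgetPex (fun=> 0)); exists g.
set h := xget _ _ in h1 h2 h3 *.
case: gP => g1 g2 g3.
apply: complex_eq; apply/eqP; rewrite -subr_eq0; apply/eqP.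
  apply: (@cont_ae_eq0 R a b c (fun x =>
    complex.Re (h x) - complex.Re (g x))) => //.
    by move=> x; apply: cvgB; [exact: h1|exact: g1].
  by apply: ae_imply2 h3 g3 => x H K xab; rewrite -H// -K// subrr.
apply: (@cont_ae_eq0 R a b c (fun x =>
  complex.Im (h x) - complex.Im (g x))) => //.
  by move=> x; apply: cvgB; [exact: h2|exact: g2].
by apply: ae_imply2 h3 g3 => x H K xab; rewrite -H// -K// subrr.
Qed.

(** * Real polynomials as test states *)

Definition cpoly (R : realType) (p : {poly R}) (x : R) : R[i] := (p.[x])%:C.

(** The inner product with a real polynomial, on which conjugation is
invisible. *)
Definition pairing (R : realType) (a b : R) (f : R -> R[i]) (q : {poly R}) :
  R[i] :=
  cintegral a b (fun x => f x * cpoly q x).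

Lemma horner_primitive (R : realType) (a b : R) (p : {poly R}) :
  is_primitive a b (horner p) (horner p^`()).
Proof. by rewrite derivE; apply: smooth_primitive; exact: smooth_horner. Qed.

Lemma horner_within (R : realType) (a b : R) (p : {poly R}) :
  {within `[a, b], continuous (horner p)}.
Proof. by apply: continuous_subspaceT; exact: continuous_horner. Qed.

Lemma horner_wderiv (R : realType) (a b : R) k (p : {poly R}) : a < b ->
  is_real_wderiv a b k (horner p) (horner p^`(k)).
Proof.
move=> ab; have lp (q : {poly R}) : locally_integrable `]a, b[ (horner q).
  by apply: integrable_locint; apply: continuous_integrable_oo;
    exact: horner_within.
elim: k => [|k IH]; first by split=> // phi _; rewrite mul1r.
rewrite -addn1; apply: (real_wderivD ab IH); split=> // phi tphi.
rewrite addn1 derivnS expr1 mulN1r /=.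
by apply: primitive_test => //; exact: horner_primitive.
Qed.

Lemma cpoly_wderiv (R : realType) (a b : R) k (p : {poly R}) : a < b ->
  is_wderiv a b k (cpoly p) (cpoly p^`(k)).
Proof.
move=> ab; apply/is_wderivP; split; first exact: horner_wderiv.
have := @horner_wderiv R a b k 0 ab; rewrite linear0.
by rewrite (_ : horner 0 = fun=> 0)//; apply/funext => x; rewrite horner0.
Qed.

Lemma cpoly_cont (R : realType) (a b : R) (p : {poly R}) :
  {within `[a, b], continuous (fun x => complex.Re (cpoly p x))} /\
  {within `[a, b], continuous (fun x => complex.Im (cpoly p x))}.
Proof.
by split; [exact: horner_within|apply: continuous_subspaceT => x;
  exact: cvg_cst].
Qed.

Lemma cpoly_inL2 (R : realType) (a b : R) (p : {poly R}) : inL2 a b (cpoly p).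
Proof. by have [? ?] := @cpoly_cont R a b p; exact: cont_inL2. Qed.

Lemma cpoly_inH (R : realType) (a b : R) k (p : {poly R}) :
  a < b -> inH k a b (cpoly p).
Proof.
move=> ab; split; first exact: cpoly_inL2.
by move=> j _; exists (cpoly p^`(j)); split;
  [exact: cpoly_wderiv|exact: cpoly_inL2].
Qed.

Lemma cpoly_wderiv_inL2 (R : realType) (a b : R) k (p : {poly R}) : a < b ->
  wderiv_inL2 a b k (cpoly p).
Proof. by move=> ab; exists (cpoly p^`(k)); split;
  [exact: cpoly_wderiv|exact: cpoly_inL2]. Qed.

Lemma cpoly_wderiv_ae (R : realType) (a b : R) k (p : {poly R}) : a < b ->
  ae_eq_oo a b (wderiv a b k (cpoly p)) (cpoly p^`(k)).
Proof.
move=> ab; apply: (wderiv_uniq ab); last exact: cpoly_wderiv.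
by apply: wderivP; exact: cpoly_wderiv_inL2.
Qed.

Lemma pval_cpoly (R : realType) (a b c : R) (p : {poly R}) :
  a < b -> a <= c <= b ->
  pval a b (cpoly p) c = (p.[c])%:C.
Proof.
move=> ab acb; apply: (@pval_eq _ _ _ _ _ (cpoly p)) => //.
by have [? ?] := @cpoly_cont R a b p; split=> //; apply: aeW.
Qed.

Lemma pval_wderiv_cpoly (R : realType) (a b c : R) (p : {poly R}) :
  a < b -> a <= c <= b ->
  pval a b (wderiv a b 1 (cpoly p)) c = (p^`().[c])%:C.
Proof.
move=> ab acb; apply: (@pval_eq _ _ _ _ _ (cpoly p^`())) => //.
by have [? ?] := @cpoly_cont R a b p^`(); split=> //; exact: cpoly_wderiv_ae.
Qed.

Lemma Rintegral_ae (R : realType) (a b : R) (f g : R -> R) :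
  measurable_fun `]a, b[ f -> measurable_fun `]a, b[ g ->
  {ae @mu R, forall x, `]a, b[%classic x -> f x = g x} ->
  \int[mu]_(x in `]a, b[) f x = \int[mu]_(x in `]a, b[) g x.
Proof.
move=> mf mg fg; congr fine; apply: ae_eq_integral => //;
  [exact/measurable_EFinP|exact/measurable_EFinP|].
by apply: ae_imply fg => x H xab; rewrite H.
Qed.

Lemma cintegral_ae (R : realType) (a b : R) (f g : R -> R[i]) :
  cmeasurable_oo a b f -> cmeasurable_oo a b g -> ae_eq_oo a b f g ->
    cintegral a b f = cintegral a b g.
Proof.
move=> [f1 f2] [g1 g2] fg; rewrite /cintegral; congr (_ +i* _);
  apply: Rintegral_ae => //.
  by apply: ae_imply fg => x H xab; rewrite H.
by apply: ae_imply fg => x H xab; rewrite H.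
Qed.

Lemma cmeasurableM (R : realType) (a b : R) (f g : R -> R[i]) :
  cmeasurable_oo a b f -> cmeasurable_oo a b g ->
    cmeasurable_oo a b (fun x => f x * g x).
Proof.
move=> [f1 f2] [g1 g2]; split.
  have : measurable_fun `]a, b[ (fun x =>
    complex.Re (f x) * complex.Re (g x) - complex.Im (f x) * complex.Im (g x)).
    by apply: measurable_funB; exact: measurable_funM.
  by apply: eq_measurable_fun => x _; case: (f x) (g x) => [? ?] [? ?].
have : measurable_fun `]a, b[ (fun x =>
  complex.Re (f x) * complex.Im (g x) + complex.Im (f x) * complex.Re (g x)).
  by apply: measurable_funD; exact: measurable_funM.
by apply: eq_measurable_fun => x _; case: (f x) (g x) => [? ?] [? ?].
Qed.

Lemma cmeasurableZ (R : realType) (a b c : R) (f : R -> R[i]) :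
  cmeasurable_oo a b f -> cmeasurable_oo a b (fun x => c%:C * f x).
Proof. by apply: cmeasurableM; split; exact: measurable_cst. Qed.

Lemma cmeasurable_conj (R : realType) (a b : R) (f : R -> R[i]) :
  cmeasurable_oo a b f -> cmeasurable_oo a b (fun x => conjc (f x)).
Proof.
move=> [f1 f2]; split.
  by move: f1; apply: eq_measurable_fun => x _; case: (f x).
have : measurable_fun `]a, b[ (fun x =>
  - complex.Im (f x)) by exact: measurableT_comp.
by apply: eq_measurable_fun => x _; case: (f x).
Qed.

Lemma cpoly_measurable (R : realType) (a b : R) (p : {poly R}) :
  cmeasurable_oo a b (cpoly p).
Proof. by apply: cintegrable_measurable; apply: inL2_cintegrable;
  exact: cpoly_inL2. Qed.

Lemma pairing_ae (R : realType) (a b : R) (f g : R -> R[i]) q :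
  cmeasurable_oo a b f -> cmeasurable_oo a b g -> ae_eq_oo a b f g ->
    pairing a b f q = pairing a b g q.
Proof.
move=> mf mg fg; have mq := @cpoly_measurable R a b q.
by apply: cintegral_ae; [exact: cmeasurableM|exact: cmeasurableM|apply:
  ae_imply fg => x H xab; rewrite H].
Qed.

Lemma dotL2_cpoly (R : realType) (a b : R) (f g : R -> R[i]) q :
  cmeasurable_oo a b f -> cmeasurable_oo a b g -> ae_eq_oo a b g (cpoly q) ->
    dotL2 a b f g = pairing a b f q.
Proof.
move=> mf mg gq; have mq := @cpoly_measurable R a b q.
apply: cintegral_ae; [apply: cmeasurableM => //;
  exact: cmeasurable_conj|exact: cmeasurableM|].
by apply: ae_imply gq => x H xab; rewrite H// /cpoly /= oppr0.
Qed.

Lemma dotL2_wderiv_cpoly (R : realType) (a b : R) k (f : R -> R[i]) p : a < b ->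
  cmeasurable_oo a b f -> dotL2 a b f (wderiv a b k (cpoly p)) =
    pairing a b f p^`(k).
Proof.
move=> ab mf; apply: dotL2_cpoly => //; last exact: cpoly_wderiv_ae.
exact: wderiv_measurable (wderivP (cpoly_wderiv_inL2 k p ab)).
Qed.

Lemma pairing0 (R : realType) (a b : R) (f : R -> R[i]) : pairing a b f 0 = 0.
Proof.
apply: complex_eq; rewrite /pairing /cpoly ?Re_cintegral ?Im_cintegral /=.
  under eq_Rintegral do rewrite horner0 mulr0.
  by rewrite Rintegral_cst// mul0r.
under eq_Rintegral do rewrite horner0 mulr0.
by rewrite Rintegral_cst// mul0r.
Qed.

Lemma pairingD (R : realType) (a b : R) (f g : R ->
  R[i]) q : cintegrable_oo a b f -> cintegrable_oo a b g ->
  pairing a b (fun x => f x + g x) q = pairing a b f q + pairing a b g q.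
Proof.
move=> [f1 f2] [g1 g2]; have cq := @horner_within R a b q.
apply: complex_eq; rewrite ?ReD ?ImD /pairing /cpoly ?Re_cintegral
  ?Im_cintegral.
  rewrite -RintegralD//; [|exact: integrable_ooM|exact: integrable_ooM].
  by apply: eq_Rintegral => x _; rewrite ReD mulrDl.
rewrite -RintegralD//; [|exact: integrable_ooM|exact: integrable_ooM].
by apply: eq_Rintegral => x _; rewrite ImD mulrDl.
Qed.

Lemma pairingZ (R : realType) (a b k : R) (f : R ->
  R[i]) q : cintegrable_oo a b f ->
  pairing a b (fun x => k%:C * f x) q = k%:C * pairing a b f q.
Proof.
move=> [f1 f2]; have cq := @horner_within R a b q.
rewrite [RHS]mulrC; apply: complex_eq;
  rewrite ?ReMr ?ImMr /pairing /cpoly ?Re_cintegral ?Im_cintegral.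
  rewrite mulrC -RintegralZl//; last exact: integrable_ooM.
  by apply: eq_Rintegral => x _; rewrite (mulrC _ (f x)) ReMr mulrAC mulrC.
rewrite mulrC -RintegralZl//; last exact: integrable_ooM.
by apply: eq_Rintegral => x _; rewrite (mulrC _ (f x)) ImMr mulrAC mulrC.
Qed.

Lemma pairing_parts (R : realType) (a b : R) (F f : R -> R[i]) q : a < b ->
  is_cprimitive a b F f ->
  pairing a b f q = F b * cpoly q b - F a * cpoly q a - pairing a b F q^`().
Proof.
move=> ab [Fr Fi].
apply: complex_eq; rewrite !(ReD, ImD, ReN, ImN) ?ReMr ?ImMr /pairing /cpoly
  ?Re_cintegral ?Im_cintegral.
  exact: primitive_parts ab Fr (@horner_primitive R a b q).
exact: primitive_parts ab Fi (@horner_primitive R a b q).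
Qed.

(** * Regularity and integration by parts *)

Lemma continuous_rep_primitive (R : realType) (a b : R) (g F f : R -> R[i]) :
  a < b ->
  is_cprimitive a b F f -> ae_eq_oo a b g F -> continuous_rep a b g F.
Proof. by move=> ab /(cprimitive_continuous ab)[? ?] gF; split. Qed.

Lemma cprimitive_inL2 (R : realType) (a b : R) (F f : R -> R[i]) : a < b ->
  is_cprimitive a b F f -> inL2 a b F.
Proof. by move=> ab /(cprimitive_continuous ab)[? ?]; exact: cont_inL2. Qed.

Lemma wderiv_ae (R : realType) (a b : R) k (f g : R -> R[i]) : a < b ->
  is_wderiv a b k f g -> inL2 a b g -> ae_eq_oo a b (wderiv a b k f) g.
Proof.
move=> ab fg g2; apply: (wderiv_uniq ab _ fg); apply: wderivP; by exists g.
Qed.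

Lemma H2_structure (R : realType) (a b : R) (u : R -> R[i]) : a < b ->
  wderiv_inL2 a b 1 u -> wderiv_inL2 a b 2 u ->
  exists F g, [/\ is_cprimitive a b F g, ae_eq_oo a b (wderiv a b 1 u) F,
    ae_eq_oo a b (wderiv a b 2 u) g & cintegrable_oo a b g].
Proof.
move=> ab [g1 [ug1 g1L]] [g2 [ug2 g2L]].
have [F Fg2 g1F] := wderiv1_primitive ab (wderiv_sub (j := 1) (k :=
  1) ab ug1 ug2) (inL2_cintegrable g2L).
exists F, g2; split=> //; [|exact: wderiv_ae|exact: inL2_cintegrable].
exact: ae_eq_oo_trans (wderiv_ae ab ug1 g1L) g1F.
Qed.

(** The second derivative is itself twice weakly differentiable, so its first
derivative [G] exists and is absolutely continuous, and so is the second
derivative. *)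
Lemma H4_structure (R : realType) (a b : R) (u : R -> R[i]) : a < b ->
  wderiv_inL2 a b 2 u -> wderiv_inL2 a b 4 u ->
  exists F G g, [/\ is_cprimitive a b F G, is_cprimitive a b G g &
    cintegrable_oo a b g] /\
    [/\ wderiv_inL2 a b 3 u, ae_eq_oo a b (wderiv a b 2 u) F,
     ae_eq_oo a b (wderiv a b 3 u) G & ae_eq_oo a b (wderiv a b 4 u) g].
Proof.
move=> ab [g2 [ug2 g2L]] [g4 [ug4 g4L]].
have [G Gg4 g2G] := wderiv2_primitive ab (wderiv_sub (j := 2) (k :=
  2) ab ug2 ug4) (inL2_cintegrable g4L).
have GL := cprimitive_inL2 ab Gg4.
have [F FG g2F] := wderiv1_primitive ab g2G (inL2_cintegrable GL).
have uG := wderivD ab ug2 g2G.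
exists F, G, g4; split; split=> //;
  [exact: inL2_cintegrable|by exists G| |exact: wderiv_ae|exact: wderiv_ae].
exact: ae_eq_oo_trans (wderiv_ae ab ug2 g2L) g2F.
Qed.

(** Two integrations by parts for the bending term and one for the damping
term; [B] collects the shear force paired with the displacement and the
bending moment paired with the slope. *)
Lemma beam_parts (R : realType) (a b rho : R) (u s : R ->
  R[i]) (p : {poly R}) : a < b ->
  wderiv_inL2 a b 2 u -> wderiv_inL2 a b 4 u ->
  wderiv_inL2 a b 1 s -> wderiv_inL2 a b 2 s ->
  let B c := pval a b (wderiv a b 2 u) c * cpoly p^`() c
    - (pval a b (wderiv a b 3 u) c - rho%:C * pval a b (wderiv a b 1 s) c) *
      cpoly p c in
  dotL2 a b (fun x => - wderiv a b 4 u x +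
    rho%:C * wderiv a b 2 s x) (cpoly p) =
  B b - B a - dotL2 a b (wderiv a b 2 u) (wderiv a b 2 (cpoly p))
  - rho%:C * dotL2 a b (wderiv a b 1 s) (wderiv a b 1 (cpoly p)).
Proof.
move=> ab u2L u4L s1L s2L B.
have [F [G [g [[FG Gg gL] [_ uF uG ug]]]]] := H4_structure ab u2L u4L.
have [S [h [Sh sS sh hL]]] := H2_structure ab s1L s2L.
have mu2 := wderiv_measurable (wderivP u2L);
  have mu4 := wderiv_measurable (wderivP u4L).
have ms1 := wderiv_measurable (wderivP s1L);
  have ms2 := wderiv_measurable (wderivP s2L).
have FL := inL2_cintegrable (cprimitive_inL2 ab FG);
  have SL := inL2_cintegrable (cprimitive_inL2 ab Sh).
have BE c : a <= c <= b ->
  B c = F c * cpoly p^`() c - (G c - rho%:C * S c) * cpoly p c.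
  move=> acb; rewrite /B.
  by rewrite (pval_eq ab acb (continuous_rep_primitive ab FG uF))
    (pval_eq ab acb (continuous_rep_primitive ab Gg uG)) (pval_eq ab acb
      (continuous_rep_primitive ab Sh sS)).
rewrite !BE ?lexx ?ltW//.
rewrite !dotL2_wderiv_cpoly// (pairing_ae _ mu2 (cintegrable_measurable FL) uF)
  (pairing_ae _ ms1 (cintegrable_measurable SL) sS).
pose k x := (-1)%:C * g x + rho%:C * h x.
have -> : dotL2 a b (fun x =>
  - wderiv a b 4 u x + rho%:C * wderiv a b 2 s x) (cpoly p) = pairing a b k p.
  have m4 := cmeasurableZ (-1) mu4; have m2 := cmeasurableZ rho ms2.
  have kE x : - wderiv a b 4 u x + rho%:C * wderiv a b 2 s x =
      (-1)%:C * wderiv a b 4 u x + rho%:C * wderiv a b 2 s x.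
    by rewrite rmorphN1 mulN1r.
  under [in LHS]eq_fun do rewrite kE.
  rewrite (dotL2_cpoly (q := p));
    [|exact: cmeasurableD|exact: cpoly_measurable|exact: ae_eq_oo_refl].
  apply: pairing_ae; [exact: cmeasurableD|by apply: cintegrable_measurable;
    apply: cintegrableD; exact: cintegrableZ|].
  by apply: ae_imply2 ug sh => x H K xab; rewrite H// K.
rewrite pairingD; [|exact: cintegrableZ|exact: cintegrableZ];
  rewrite !pairingZ// (pairing_parts _ ab Sh) (pairing_parts _ ab Gg)
    (pairing_parts _ ab FG).
rewrite rmorphN1 derivn1 derivnS derivn1.
ring.
Qed.

Lemma string_parts (R : realType) (a b beta : R) (v s : R ->
  R[i]) (q : {poly R}) : a < b ->
  wderiv_inL2 a b 1 v -> wderiv_inL2 a b 2 v -> inL2 a b s ->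
  dotL2 a b (fun x => wderiv a b 2 v x - beta%:C * s x) (cpoly q) =
  pval a b (wderiv a b 1 v) b * cpoly q b - pval a b (wderiv a b 1 v) a * cpoly
    q a
  - dotL2 a b (wderiv a b 1 v) (wderiv a b 1 (cpoly q)) - beta%:C * dotL2 a b s
    (cpoly q).
Proof.
move=> ab v1L v2L sL.
have [V [h [Vh vV vh hL]]] := H2_structure ab v1L v2L.
have mv1 := wderiv_measurable (wderivP v1L);
  have mv2 := wderiv_measurable (wderivP v2L).
have ms := cintegrable_measurable (inL2_cintegrable sL).
have VL := inL2_cintegrable (cprimitive_inL2 ab Vh).
rewrite !(pval_eq ab _ (continuous_rep_primitive ab Vh vV)) ?lexx ?ltW//.
rewrite !dotL2_wderiv_cpoly// (pairing_ae _ mv1 (cintegrable_measurable VL) vV).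
rewrite (dotL2_cpoly ms (cpoly_measurable a b q) (ae_eq_oo_refl a b _)).
pose k x := h x + (- beta)%:C * s x.
have -> : dotL2 a b (fun x => wderiv a b 2 v x - beta%:C * s x) (cpoly q) =
  pairing a b k q.
  have kE x : wderiv a b 2 v x - beta%:C * s x =
    wderiv a b 2 v x + (- beta)%:C * s x.
    by rewrite rmorphN mulNr.
  under [in LHS]eq_fun do rewrite kE.
  have m1 := cmeasurableZ (- beta) ms.
  rewrite (dotL2_cpoly (q := q));
    [|exact: cmeasurableD|exact: cpoly_measurable|exact: ae_eq_oo_refl].
  apply: pairing_ae; [exact: cmeasurableD| |].
    by apply: cintegrable_measurable; apply: cintegrableD => //;
      apply: cintegrableZ; exact: inL2_cintegrable.
  by apply: ae_imply vh => x H xab; rewrite H.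
have sL1 := inL2_cintegrable sL.
rewrite pairingD//; last exact: cintegrableZ.
rewrite pairingZ// (pairing_parts _ ab Vh) rmorphN derivn1.
ring.
Qed.

(** * Transmission conditions *)

(** The conditions at [l0] and [l3] clamp the outer ends, the last two make the
state continuous at the joints. *)
Lemma cpoly_inHH (R : realType) (l0 l1 l2 l3 : R) (p q r : {poly R}) :
  l0 < l1 -> l1 < l2 -> l2 < l3 ->
  p.[l0] = 0 -> p^`().[l0] = 0 -> r.[l3] = 0 -> r^`().[l3] = 0 ->
  p.[l1] = q.[l1] -> q.[l2] = r.[l2] ->
  inHH l0 l1 l2 l3 (cpoly p) (cpoly q) (cpoly r).
Proof.
move=> h1 h2 h3 p0 p'0 r0 r'0 pq qr; split.
- split; first exact: cpoly_inH.
    by rewrite pval_cpoly ?lexx ?ltW// p0.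
  by rewrite pval_wderiv_cpoly ?lexx ?ltW// p'0.
- exact: cpoly_inH.
- split; first exact: cpoly_inH.
    by rewrite pval_cpoly ?lexx ?ltW// r0.
  by rewrite pval_wderiv_cpoly ?lexx ?ltW// r'0.
- by rewrite !pval_cpoly ?lexx ?ltW// pq.
- by rewrite !pval_cpoly ?lexx ?ltW// qr.
Qed.

(** The weak transmission condition tested with the state
[(0, 0, 0, p, q, r)], after integration by parts.  The clamped ends contribute
nothing, and [q] has been eliminated through its values at the joints. *)
Lemma boundary_identity (R : realType) (l0 l1 l2 l3 rho1 rho2 beta : R)
    (U : state R) (p q r : {poly R}) :
  l0 < l1 -> l1 < l2 -> l2 < l3 -> domA l0 l1 l2 l3 rho1 rho2 beta U ->
  p.[l0] = 0 -> p^`().[l0] = 0 -> r.[l3] = 0 -> r^`().[l3] = 0 ->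
  p.[l1] = q.[l1] -> q.[l2] = r.[l2] ->
  pval l0 l1 (wderiv l0 l1 2 (u1 U)) l1 * cpoly p^`() l1
  - (pval l0 l1 (wderiv l0 l1 3 (u1 U)) l1
     - rho1%:C * pval l0 l1 (wderiv l0 l1 1 (u2 U)) l1
     + pval l1 l2 (wderiv l1 l2 1 (v1 U)) l1) * cpoly p l1
  - pval l2 l3 (wderiv l2 l3 2 (w1 U)) l2 * cpoly r^`() l2
  + (pval l2 l3 (wderiv l2 l3 3 (w1 U)) l2
     - rho2%:C * pval l2 l3 (wderiv l2 l3 1 (w2 U)) l2
     + pval l1 l2 (wderiv l1 l2 1 (v1 U)) l2) * cpoly r l2 = 0.
Proof.
move=> hl01 hl12 hl23 hU p0 p'0 r0 r'0 pq qr.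
case: hU => [[[[u1H _ _] v1H [w1H _ _] _ _] [[u2H _ _] v2H [w2H _ _] _ _]] u14
  v12 w14 weak].
have VH := cpoly_inHH hl01 hl12 hl23 p0 p'0 r0 r'0 pq qr.
have ZH : inHH l0 l1 l2 l3 (cpoly 0) (cpoly 0) (cpoly 0 : R -> R[i]).
  by apply: cpoly_inHH; rewrite ?deriv0 ?horner0.
have := weak (State (cpoly 0) (cpoly 0) (cpoly 0) (cpoly p) (cpoly q) (cpoly
  r)) (conj ZH VH).
rewrite /dotE /dotHH /dotLL /aform /opA /dotH2 /=.
have u22 := u2H.2 2%N isT; have u21 := u2H.2 1%N isT.
have w22 := w2H.2 2%N isT; have w21 := w2H.2 1%N isT.
have u12 := u1H.2 2%N isT; have w12 := w1H.2 2%N isT.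
have v11 := v1H.2 1%N isT; have v21 := v2H.2 1%N isT.
rewrite (beam_parts rho1 p hl01 u12 u14 u21 u22) (beam_parts rho2 r hl23 w12
  w14 w21 w22).
rewrite (string_parts beta q hl12 v11 v12 v2H.1).
have z1 : dotL2 l0 l1 (wderiv l0 l1 2 (u2 U)) (wderiv l0 l1 2 (cpoly 0)) = 0.
  by rewrite dotL2_wderiv_cpoly// ?linear0 ?pairing0//;
    exact: wderiv_measurable (wderivP u22).
have z2 : dotL2 l1 l2 (wderiv l1 l2 1 (v2 U)) (wderiv l1 l2 1 (cpoly 0)) = 0.
  by rewrite dotL2_wderiv_cpoly// ?linear0 ?pairing0//;
    exact: wderiv_measurable (wderivP v21).
have z3 : dotL2 l2 l3 (wderiv l2 l3 2 (w2 U)) (wderiv l2 l3 2 (cpoly 0)) = 0.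
  by rewrite dotL2_wderiv_cpoly// ?linear0 ?pairing0//;
    exact: wderiv_measurable (wderivP w22).
rewrite z1 z2 z3.
have -> : cpoly p l0 = 0 by rewrite /cpoly p0.
have -> : cpoly p^`() l0 = 0 by rewrite /cpoly p'0.
have -> : cpoly r l3 = 0 by rewrite /cpoly r0.
have -> : cpoly r^`() l3 = 0 by rewrite /cpoly r'0.
have -> : cpoly q l1 = cpoly p l1 by rewrite /cpoly pq.
have -> : cpoly q l2 = cpoly r l2 by rewrite /cpoly qr.
move=> /eqP; rewrite -subr_eq0 => /eqP E; rewrite -{}E.
(* Abstracting the values leaves an identity between ring expressions in few
   small atoms. *)
repeat match goal with |- context [dotL2 ?a ?b ?f ?g] =>
  let x := fresh "d" in generalize (dotL2 a b f g); intro x end.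
repeat match goal with |- context [pval ?a ?b ?f ?g] =>
  let x := fresh "v" in generalize (pval a b f g); intro x end.
repeat match goal with |- context [cpoly ?a ?b] =>
  let x := fresh "p" in generalize (cpoly a b); intro x end.
ring.
Qed.

Lemma inH4_of_wderiv (R : realType) (a b : R) (f : R -> R[i]) : a < b ->
  inH 2 a b f -> wderiv_inL2 a b 4 f -> inH 4 a b f.
Proof.
move=> ab [fL f12] f4; split=> // -[//|[|[|[|[|//]]]]] _ //.
- exact: f12.
- exact: f12.
- by have [F [G [g [_ []]]]] := H4_structure ab (f12 2%N isT) f4.
Qed.

(** A cubic clamped at [a] that moves the slope at [b] without moving the
value. *)
Lemma cubic_values (R : comNzRingType) (a b : R)
    (p := ('X - a%:P) * ('X - a%:P) * ('X - b%:P)) :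
  [/\ p.[a] = 0, p^`().[a] = 0, p.[b] = 0 & p^`().[b] = (b - a) * (b - a)].
Proof. by rewrite /p; split; rewrite !(poly.derivE, hornerE) //=; ring. Qed.

Lemma square_values (R : comNzRingType) (a b : R)
    (p := ('X - a%:P) * ('X - a%:P)) :
  [/\ p.[a] = 0, p^`().[a] = 0 & p.[b] = (b - a) * (b - a)].
Proof. by rewrite /p; split; rewrite !(poly.derivE, hornerE) //=; ring. Qed.

Theorem theorem4p4 (R : realType) (l0 l1 l2 l3 rho1 rho2 beta : R)
    (hl01 : l0 < l1) (hl12 : l1 < l2) (hl23 : l2 < l3)
    (hrho1 : 0 <= rho1) (hrho2 : 0 <= rho2) (hbeta : 0 <= beta)
    (U : state R) (hU : domA l0 l1 l2 l3 rho1 rho2 beta U) :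
  (inH 4 l0 l1 (u1 U) /\ inH 2 l1 l2 (v1 U) /\ inH 4 l2 l3 (w1 U)) /\
  (pval l0 l1 (wderiv l0 l1 3 (u1 U)) l1
     - rho1%:C * pval l0 l1 (wderiv l0 l1 1 (u2 U)) l1
     + pval l1 l2 (wderiv l1 l2 1 (v1 U)) l1 = 0 /\
   pval l2 l3 (wderiv l2 l3 3 (w1 U)) l2
     - rho2%:C * pval l2 l3 (wderiv l2 l3 1 (w2 U)) l2
     + pval l1 l2 (wderiv l1 l2 1 (v1 U)) l2 = 0 /\
   pval l0 l1 (wderiv l0 l1 2 (u1 U)) l1 = 0 /\
   pval l2 l3 (wderiv l2 l3 2 (w1 U)) l2 = 0).
Proof.
have bd p q r := @boundary_identity R l0 l1 l2 l3 rho1 rho2 beta U p q r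
  hl01 hl12 hl23 hU.
have nz (k : R) (z : R[i]) : k != 0 -> z * k%:C = 0 -> z = 0.
  move=> k0 /eqP; rewrite mulf_eq0 =>
    /orP[/eqP//|/eqP/(congr1 (@complex.Re R)) /= k0'].
  by rewrite k0' eqxx in k0.
have d1 : l1 - l0 != 0 by rewrite subr_eq0 gt_eqF.
have d2 : l2 - l3 != 0 by rewrite subr_eq0 lt_eqF.
have d3 : l2 - l1 != 0 by rewrite subr_eq0 gt_eqF.
split.
  case: hU => [[[[u1H _ _] [v1L v1H] [w1H _ _] _ _] _] u14 v12 w14 _].
  split; first exact: inH4_of_wderiv.
  split; last exact: inH4_of_wderiv.
  by split=> // -[//|[|[|//]]] _; [exact: v1H|].
(* The bending moments: only a slope term of the boundary identity survives. *)
have u0 : pval l0 l1 (wderiv l0 l1 2 (u1 U)) l1 = 0.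
  have [pa p'a pb p'b] := cubic_values l0 l1.
  have := bd (('X - l0%:P) * ('X - l0%:P) * ('X - l1%:P)) 0 0 pa p'a.
  rewrite /cpoly !deriv0 !horner0 pb p'b => /(_ erefl erefl erefl erefl).
  by rewrite !mulr0 !subr0 addr0 => /nz; apply; rewrite mulf_neq0.
have w0 : pval l2 l3 (wderiv l2 l3 2 (w1 U)) l2 = 0.
  have [pa p'a pb p'b] := cubic_values l3 l2.
  have := bd 0 0 (('X - l3%:P) * ('X - l3%:P) * ('X - l2%:P)).
  rewrite /cpoly !deriv0 !horner0 pb p'b => /(_ erefl erefl pa p'a erefl erefl).
  rewrite !mulr0 !subr0 addr0 sub0r -mulNr => /nz h.
  by apply/eqP; rewrite -oppr_eq0; apply/eqP; apply: h; rewrite mulf_neq0.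
(* The force balances: the bending moments are known to vanish, and the affine
   [q] vanishes at the other joint. *)
split; last split=> //.
  have [pa p'a pb] := square_values l0 l1.
  pose q : {poly R} := ((l1 - l0) * (l1 - l0) / (l1 - l2)) *: ('X - l2%:P).
  have q1 : q.[l1] = (l1 - l0) * (l1 - l0).
    by rewrite /q !hornerE divfK// subr_eq0 lt_eqF.
  have q2 : q.[l2] = 0 by rewrite /q !hornerE subrr mulr0.
  have := bd (('X - l0%:P) * ('X - l0%:P)) q 0 pa p'a.
  rewrite /cpoly !deriv0 !horner0 pb q1 q2 u0 => /(_ erefl erefl erefl erefl).
  rewrite !mulr0 mul0r !subr0 addr0 sub0r -mulNr => /nz h.
  by apply/eqP; rewrite -oppr_eq0; apply/eqP; apply: h; rewrite mulf_neq0.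
have [pa p'a pb] := square_values l3 l2.
pose q : {poly R} := ((l2 - l3) * (l2 - l3) / (l2 - l1)) *: ('X - l1%:P).
have q2 : q.[l2] = (l2 - l3) * (l2 - l3) by rewrite /q !hornerE divfK.
have q1 : q.[l1] = 0 by rewrite /q !hornerE subrr mulr0.
have := bd 0 q (('X - l3%:P) * ('X - l3%:P)).
rewrite /cpoly !deriv0 !horner0 pb q1 q2 w0 =>
  /(_ erefl erefl pa p'a erefl erefl).
by rewrite !mulr0 mul0r !subr0 add0r => /nz; apply; rewrite mulf_neq0.
Qed.
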